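(* Let $n\ge 3$ and let $\mathcal{U}=(u_1,u_2)\in C^2(\mathbb{R}^n\setminus\{0\})$ be a nonnegative singular solution of $$\Delta u_i+\frac{n(n-2)}{4}|\mathcal{U}|^{\frac{4}{n-2}}u_i=0\quad\text{in }\mathbb{R}^n\setminus\{0\},\qquad i=1,2.$$ Then $\mathcal{U}$ is radially symmetric about the origin.
   Context: $\Delta$ is the Euclidean Laplacian and $|\mathcal{U}|=(u_1^2+u_2^2)^{1/2}$. Nonnegative means $u_1\ge 0$ and $u_2\ge 0$ everywhere. The solution is called singular if $\lim_{|x|\to 0}|\mathcal{U}(x)|=+\infty$. *)

(* Defs.v *)
From HB Require Import structures.
From mathcomp Require Import all_boot all_order all_algebra.
From mathcomp Require Import all_classical all_reals all_analysis.

Set Implicit Arguments.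
Unset Strict Implicit.
Unset Printing Implicit Defensive.

Import Order.TTheory GRing.Theory Num.Theory.
Import numFieldNormedType.Exports.

Local Open Scope classical_set_scope.
Local Open Scope ring_scope.

(* The library's norm `|x| on 'rV[R]_n is the sup norm, whence a separate
   Euclidean norm.  Both induce the same topology, so the library's notions of
   limit, continuity and derivative on 'rV[R]_n are the Euclidean ones. *)
Definition enorm (R : realType) (n : nat) (x : 'rV[R]_n) : R :=
  Num.sqrt (\sum_(i < n) x ord0 i ^+ 2).

Definition partial (R : realType) (n : nat) (i : 'I_n) (f : 'rV[R]_n -> R) :
    'rV[R]_n -> R :=
  'D_(delta_mx ord0 i) f.

(* Meant for an open set A: continuity and partial derivability at the points
   of A are taken in the ambient space. *)
Fixpoint Ck (R : realType) (n k : nat) (A : set 'rV[R]_n)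
    (f : 'rV[R]_n -> R) : Prop :=
  (forall x, A x -> {for x, continuous f}) /\
  if k is k'.+1 then
    forall i : 'I_n,
      (forall x, A x -> derivable f x (delta_mx ord0 i)) /\
      Ck k' A (partial i f)
  else True.

Definition laplacian (R : realType) (n : nat) (f : 'rV[R]_n -> R) :
    'rV[R]_n -> R :=
  fun x => \sum_(i < n) partial i (partial i f) x.

(* Maps on R^n minus the origin are represented by total functions, whose value
   at the origin is irrelevant. *)
Definition punctured (R : realType) (n : nat) : set 'rV[R]_n :=
  [set x | x != 0].
Arguments punctured : clear implicits.

Definition component (R : realType) (n m : nat) (U : 'rV[R]_n -> 'rV[R]_m)
    (i : 'I_m) : 'rV[R]_n -> R :=
  fun x => U x ord0 i.

Definition radially_symmetric (R : realType) (n : nat) (T : Type)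
    (U : 'rV[R]_n -> T) : Prop :=
  forall x y, punctured R n x -> punctured R n y ->
    enorm x = enorm y -> U x = U y.

(* Main.v *)
(** The method of moving spheres.  For [x != 0] and [0 < l < |x|^2], compare [u_i] with its
    Kelvin transform in the sphere of center [x] and squared radius [l], outside that sphere.
    The transform lies below [u_i] for small [l], and the set of such [l] is closed.  It is
    also open: the nonlinearity is increasing in each component, so the difference is
    superharmonic outside the sphere, and it does not vanish identically because [|U|] blows
    up at the origin while its transform stays bounded there.  It therefore dominates a
    multiple of the Dirichlet Green function of the exterior domain, which is explicit; this
    gives at once the strict radial monotonicity at the sphere (Hopf) and the strict
    inequality at infinity and near the origin.  Hence the comparison holds up to spheres
    through the origin; as their centers go to infinity these become hyperplanes, and
    [u_i] is invariant under every reflection in a hyperplane through the origin. *)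
From HB Require Import structures.
Require Import Defs.
From mathcomp Require Import all_boot all_order all_algebra.
From mathcomp Require Import all_classical all_reals all_analysis.
From mathcomp Require Import ring lra.
Import Order.TTheory GRing.Theory Num.Theory.
Import numFieldNormedType.Exports.
Local Open Scope classical_set_scope.
Local Open Scope ring_scope.

Set Implicit Arguments.
Unset Strict Implicit.

(** * Second-order jets of real functions *)

(** The coupling shapes the argument. Only the norm of [U] is known to blow up: a single component
    may stay bounded near the origin, or vanish identically. That a positive component coincides
    with its transform is therefore excluded through the equation, which turns equality in one
    component into equality of the norms. Both components must moreover be compared at once, since
    the Laplacian of one difference involves both. The exterior domain is unbounded and punctured,
    and nothing is assumed about [U] at infinity, so openness cannot rest on compactness alone. The
    gap is measured against (1 - s) s^k, with s the squared radius over the squared distance to the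
    center and k = (n - 2) / 2: it vanishes to first order on the sphere and decays like |y|^(2 -
    n). A small enlargement of the sphere changes the transform by a small multiple of s^k, which
    the gap absorbs uniformly away from the sphere. Taking l < |x|^2 leaves the origin outside the
    sphere, so on the closed exterior the transform has no singularity and only [u_i] has one. *)

Section jets.
Context {R : realType}.
Implicit Types (f g : R -> R) (t a b c d m : R).

(** The first derivative is carried as a function [f1] defined near [t], so that product and chain
    rules follow from those of [is_derive], without rewriting inside an iterated derivative. *)
Definition jet2 f t a b := exists f1 : R -> R,
  [/\ \forall s \near t, is_derive s (1:R) f (f1 s), f1 t = a & is_derive t (1:R) f1 b].

Lemma jet2_near_eq f g t a b :
  (\forall s \near t, f s = g s) -> jet2 f t a b -> jet2 g t a b.
Proof.
move=> fg [f1 [df f1t df1]]; exists f1; split => //.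
by apply: filterS2 (near_join fg) df => s; exact: near_eq_is_derive.
Qed.

Lemma jet2_cst c t : jet2 (cst c) t 0 0.
Proof. by exists (cst 0); split => [|//|]; [near=> s|]; exact: is_derive_cst.
Unshelve. all: by end_near. Qed.

Lemma jet2_id t : jet2 id t 1 0.
Proof.
exists (cst 1); split => [|//|]; last exact: is_derive_cst.
by near=> s; exact: is_derive_id.
Unshelve. all: by end_near. Qed.

Lemma jet2_is_derive f t a b : jet2 f t a b -> is_derive t 1 f a.
Proof. by case=> f1 [/nbhs_singleton df <- _]. Qed.

Lemma jet2D f g t a b c d : jet2 f t a b -> jet2 g t c d ->
  jet2 (fun s => f s + g s) t (a + c) (b + d).
Proof.
move=> [f1 [df f1t df1]] [g1 [dg g1t dg1]]; exists (f1 + g1); split.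
- by near=> s; apply: is_deriveD; near: s.
- by rewrite -f1t -g1t.
- exact: is_deriveD.
Unshelve. all: by end_near. Qed.

Lemma jet2M f g t a b c d : jet2 f t a b -> jet2 g t c d ->
  jet2 (fun s => f s * g s) t (a * g t + f t * c)
    (b * g t + 2 * (a * c) + f t * d).
Proof.
move=> jf jg.
have dft := jet2_is_derive jf; have dgt := jet2_is_derive jg.
move: jf jg => [f1 [df f1t df1]] [g1 [dg g1t dg1]].
exists (f1 * g + f * g1); split.
- near=> s.
  have dfs : is_derive s 1 f (f1 s) by near: s.
  have dgs : is_derive s 1 g (g1 s) by near: s.
  apply: (is_derive_eq (is_deriveM dfs dgs)).
  by rewrite !fctE /GRing.scale /=; ring.
- by rewrite !fctE f1t g1t.
- apply: (is_derive_eq (is_deriveD (is_deriveM df1 dgt) (is_deriveM dft dg1))).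
  by rewrite /GRing.scale /= f1t g1t; ring.
Unshelve. all: by end_near. Qed.

Lemma jet2Zl c f t a b : jet2 f t a b -> jet2 (fun s => c * f s) t (c * a) (c * b).
Proof.
move=> jf; have := jet2M (jet2_cst c t) jf.
by rewrite /cst !(mul0r, add0r, mulr0).
Qed.

Lemma jet2_comp (h h1 : R -> R) f t a b c :
  (\forall s \near f t, is_derive s (1:R) h (h1 s)) -> is_derive (f t) (1:R) h1 c ->
  jet2 f t a b -> jet2 (fun s => h (f s)) t (h1 (f t) * a) (c * a ^+ 2 + h1 (f t) * b).
Proof.
move=> dh dh1 jf; have dft := jet2_is_derive jf; move: jf => [f1 [df f1t df1]].
have cf : f @ t --> f t.
  by apply: differentiable_continuous; apply/derivable1_diffP; case: dft.
exists ((h1 \o f) * f1); split.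
- near=> s.
  have dfs : is_derive s 1 f (f1 s) by near: s.
  have dhs : is_derive (f s) 1 h (h1 (f s)).
    by near: s; exact: (cf _ dh).
  exact: is_derive1_comp.
- by rewrite !fctE f1t.
- apply: (is_derive_eq (is_deriveM (is_derive1_comp dh1 dft) df1)).
  by rewrite /GRing.scale /= f1t; ring.
Unshelve. all: by end_near. Qed.

Lemma jet2V f t a b : f t != 0 -> jet2 f t a b ->
  jet2 (fun s => (f s)^-1) t (- a / f t ^+ 2) (2 * a ^+ 2 / f t ^+ 3 - b / f t ^+ 2).
Proof.
move=> ft0 jf.
have dinv (s : R) : s != 0 -> is_derive s 1 (fun y : R => y^-1) (- (s ^+ 2)^-1).
  move=> s0; have di := @is_deriveV R id s 1 1 s0 (is_derive_id _ _).
  apply: (is_derive_eq di).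
  by rewrite /GRing.scale /= mulr1.
have -> : - a / f t ^+ 2 = - (f t ^+ 2)^-1 * a by rewrite mulrC mulrN mulNr.
have -> : 2 * a ^+ 2 / f t ^+ 3 - b / f t ^+ 2 =
  (2 / f t ^+ 3) * a ^+ 2 + - (f t ^+ 2)^-1 * b by field.
apply: (@jet2_comp (fun y => y^-1) (fun s => - (s ^+ 2)^-1)) jf.
- near=> s; apply: dinv; near: s.
  by have := @open_neq R 0; rewrite openE => /(_ _ ft0).
- have d2 : is_derive (f t) (1:R) (fun y : R => y ^+ 2) (2 * f t).
    apply: (is_derive_eq (is_deriveM (is_derive_id (f t) (1 : R)) (is_derive_id (f t) (1 : R)))).
    by rewrite /GRing.scale /=; ring.
  have d1 := @is_deriveV R (fun y => y ^+ 2) _ _ _ (expf_neq0 2 ft0) d2.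
  apply: (is_derive_eq (is_deriveN d1)).
  by rewrite /GRing.scale /=; field.
Unshelve. all: by end_near. Qed.

Lemma jet2_powR f t a b m : 0 < f t -> jet2 f t a b ->
  jet2 (fun s => f s `^ m) t (m * f t `^ (m - 1) * a)
    (m * (m - 1) * f t `^ (m - 2) * a ^+ 2 + m * f t `^ (m - 1) * b).
Proof.
move=> ft0.
apply: (@jet2_comp (fun y => y `^ m) (fun s => m * s `^ (m - 1))).
  near=> s; apply: is_derive1_powR; near: s.
  by have := @open_gt R 0; rewrite openE => /(_ _ ft0).
have d := is_derive1_powR (m - 1) ft0.
apply: (is_derive_eq (is_deriveZ m d)).
by rewrite /GRing.scale /= mulrA -addrA -opprD.
Unshelve. all: by end_near. Qed.

Lemma is_derive_slope f t a (e : R) : is_derive t (1:R) f a -> 0 < e ->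
  exists2 d : R, 0 < d & forall s, `|s - t| < d ->
    `|f s - f t - a * (s - t)| <= e * `|s - t|.
Proof.
move=> [df <-] e0; move/cvgrPdist_le : (df) => /(_ e e0) [d /= d0 dle].
exists d => // s std.
have [->|st] := eqVneq s t; first by rewrite !subrr mulr0 subr0 normr0 mulr0.
have st0 : s - t != 0 by rewrite subr_eq0.
have /= := dle (s - t); rewrite sub0r normrN => /(_ std st0).
rewrite (_ : (s - t)%:A = s - t); last exact: mulr1.
rewrite subrK -ler_pdivrMr ?normr_gt0//; apply: le_trans.
rewrite -normrV ?unitfE// -normrM distrC /GRing.scale /= mulrBl mulfK//.
by rewrite [_^-1 * _]mulrC.
Qed.

Lemma is_derive_right_ge0 f t a (d : R) : is_derive t (1:R) f a -> 0 < d ->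
  (forall s, t <= s < t + d -> f t <= f s) -> 0 <= a.
Proof.
move=> df d0 ft; rewrite leNgt; apply/negP => a0.
have /(is_derive_slope df) [d' d'0 sl] : 0 < - a / 2 by lra.
pose m := Num.min d d' / 2.
have m0 : 0 < m by rewrite /m divr_gt0// lt_min d0.
have [md md'] : m < d /\ m < d'.
  by rewrite /m; split; case: (ltP d d') => ?; lra.
have := sl (t + m); have -> : t + m - t = m by ring.
rewrite (gtr0_norm m0) => /(_ md').
have := ft (t + m); rewrite lerDl ltrD2l (ltW m0) md => /(_ isT) + /ler_normlP [].
by nra.
Qed.

Lemma is_derive_min f t a : is_derive t (1:R) f a ->
  (\forall s \near t, f t <= f s) -> a = 0.
Proof.
move=> df [d /= d0 ft]; apply/eqP; rewrite eq_le; apply/andP; split.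
  have dN : is_derive (- t) (1:R) (f \o -%R) (- a).
    have dNt : is_derive (- - t) (1:R) f a by rewrite opprK.
    have d2 := @is_derive1_comp R f -%R _ _ _ dNt (is_deriveNid _ _).
    by apply: (is_derive_eq d2); rewrite mulrN1.
  rewrite -oppr_ge0; apply: (is_derive_right_ge0 dN d0) => s /andP[ts sd] /=.
  by rewrite opprK; apply: ft => /=; rewrite opprK ger0_norm; lra.
apply: (is_derive_right_ge0 df d0) => s /andP[ts sd] /=.
by apply: ft => /=; rewrite distrC ger0_norm; lra.
Qed.

(** If [b < 0], then [f1], which vanishes at [t], is negative just to its right, and the mean value
    theorem puts [f] below its minimum. *)
Lemma jet2_min f t a b :
  (\forall s \near t, f t <= f s) -> jet2 f t a b -> 0 <= b.
Proof.
move=> fmin jf; have a0 := is_derive_min (jet2_is_derive jf) fmin.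
move: jf => [f1 [df f1t df1]]; rewrite leNgt; apply/negP => b0.
have /(is_derive_slope df1) [d d0 sl] : 0 < - b / 2 by lra.
have [d' /= d'0 H] := filterI fmin df.
pose m := Num.min d d' / 2.
have m0 : 0 < m by rewrite /m divr_gt0// lt_min d0.
have [md md'] : m < d /\ m < d'.
  by rewrite /m; split; case: (ltP d d') => ?; lra.
have ball (s : R) : t <= s <= t + m -> `|t - s| < d'.
  by move=> /andP[? ?]; rewrite distrC ger0_norm; lra.
have [|||c /[!in_itv]/= /andP[tc cm] E] := @MVT R f f1 t (t + m).
- by lra.
- move=> s; rewrite in_itv /= => /andP[? ?].
  have hs : t <= s <= t + m by lra.
  by case: (H s (ball _ hs)).
- apply: derivable_within_continuous => s; rewrite in_itv /= => hs.
  by case: (H s (ball _ hs)) => _ [].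
have htm : t <= t + m <= t + m by lra.
have [ftm _] := H _ (ball _ htm).
have := sl c; rewrite ger0_norm; last by lra.
rewrite f1t a0 => /(_ _)/ler_normlP []; first by lra.
rewrite subr0 => _ h.
have fc0 : f1 c < 0 by nra.
move: E; have -> : t + m - t = m by ring.
by nra.
Qed.
End jets.

(** * Continuous partial derivatives imply differentiability *)

Lemma is_derive_line (R : realType) (V : normedModType R) (f : V -> R) (q v : V) (s : R) :
  derivable f (q + s *: v) v -> is_derive s (1:R) (fun t => f (q + t *: v)) ('D_v f (q + s *: v)).
Proof.
have E : (fun h : R => h^-1 *: (((fun t : R => f (q + t *: v)) \o shift s) (h *: (1:R))
           - f (q + s *: v))) =
         (fun h => h^-1 *: ((f \o shift (q + s *: v)) (h *: v) - f (q + s *: v))).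
  apply/funext => h /=; congr (_ *: (f _ - _)).
  by rewrite scalerDl [h%:A]mulr1 addrCA.
by move=> df; split; rewrite /derivable /derive E.
Qed.

Lemma cvg_sumR (R : realType) (T : Type) (F : set_system T) (FF : Filter F) (I : Type)
  (r : seq I) (f : I -> T -> R) (l : I -> R) :
  (forall i, f i @ F --> l i) -> \sum_(i <- r) f i x @[x --> F] --> \sum_(i <- r) l i.
Proof.
move=> fl; elim: r => [|i r ih].
  by rewrite big_nil; under eq_fun do rewrite big_nil; exact: cvg_cst.
by rewrite big_cons; under eq_fun do rewrite big_cons; exact: cvgD.
Qed.

Section C1.
Context {R : realType} {n : nat}.
Implicit Types (f : 'rV[R]_n -> R) (x y p q h : 'rV[R]_n).

Local Notation e_ j := (delta_mx ord0 j : 'rV[R]_n).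

Definition rowdot (c h : 'rV[R]_n) : R := \sum_j h ord0 j * c ord0 j.

Lemma rowdot_is_linear c : linear (rowdot c : 'rV[R]_n -> R^o).
Proof.
move=> a x y; rewrite /rowdot scaler_sumr -big_split; apply: eq_bigr => j _ /=.
by rewrite !mxE mulrDl -scalerAl.
Qed.

HB.instance Definition _ c :=
  GRing.isLinear.Build R 'rV[R]_n R^o _ (rowdot c) (rowdot_is_linear c).

Lemma rowdot_continuous c : continuous (rowdot c).
Proof.
move=> x; apply: (@cvg_sumR R _ (nbhs x)) => j; apply: cvgMr_tmp; exact: coord_continuous.
Qed.

Definition prefix_row (m : nat) h : 'rV[R]_n := \row_j (if (j < m)%N then h ord0 j else 0).

Lemma prefix_row0 h : prefix_row 0 h = 0.
Proof. by apply/rowP => j; rewrite !mxE. Qed.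

Lemma prefix_row_full h : prefix_row n h = h.
Proof. by apply/rowP => j; rewrite !mxE ltn_ord. Qed.

Lemma prefix_rowS (j : 'I_n) h : prefix_row j.+1 h = prefix_row j h + h ord0 j *: e_ j.
Proof.
apply/rowP => i; rewrite !mxE eqxx /= ltnS leq_eqVlt.
have [->|ij] := eqVneq i j; first by rewrite ltnn eqxx /= mulr1 add0r.
by rewrite (negbTE (ij : (i != j :> nat))) /= mulr0 addr0.
Qed.

Lemma rV_norm_le h (e : R) : 0 <= e -> (forall j, `|h ord0 j| <= e) -> `|h| <= e.
Proof.
move=> e0 he; rewrite [leLHS]/Num.Def.normr /= mx_normrE.
by apply: bigmax_le => // -[i j] _ /=; rewrite ord1.
Qed.

Lemma coord_norm_le h j : `|h ord0 j| <= `|h|.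
Proof.
rewrite [leRHS]/Num.Def.normr /= mx_normrE.
exact: (le_bigmax _ (fun ij => `|h ij.1 ij.2|) (ord0, j)).
Qed.

Lemma coord_MVT f q j (c : R) :
  (forall s, `|s| <= `|c| -> derivable f (q + s *: e_ j) (e_ j)) ->
  exists2 s, `|s| <= `|c| & f (q + c *: e_ j) - f q = partial j f (q + s *: e_ j) * c.
Proof.
move=> df.
have dphi (s : R) : 0 <= s <= 1 -> is_derive s (1:R) (fun s => f (q + (s * c) *: e_ j))
    (partial j f (q + (s * c) *: e_ j) * c).
  move=> /andP[s0 s1].
  have d1 : is_derive s (1:R) (fun s : R => s * c) c.
    apply: (is_derive_eq (is_deriveM (is_derive_id s (1:R)) (is_derive_cst c s (1:R)))).
    by rewrite /GRing.scale /=; ring.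
  apply: (@is_derive1_comp R (fun t => f (q + t *: e_ j)) (fun s => s * c)).
  apply: is_derive_line; apply: df.
  by rewrite normrM ger0_norm// ler_piMl.
have [|||s /[!in_itv]/= s01 E] := @MVT R (fun s => f (q + (s * c) *: e_ j))
  (fun s => partial j f (q + (s * c) *: e_ j) * c) 0 1.
- exact: ltr01.
- by move=> s; rewrite in_itv /= => /andP[/ltW s0 /ltW s1]; apply: dphi; rewrite s0.
- apply: derivable_within_continuous => s; rewrite in_itv /= => hs.
  by case: (dphi s hs).
exists (s * c).
  by rewrite normrM ger0_norm ?ler_piMl//; lra.
by move: E; rewrite mul1r mul0r scale0r addr0 subr0 mulr1.
Qed.

(** The increment is telescoped through [prefix_row], which switches on one coordinate of [h] at a
    time; on each edge the mean value theorem leaves an error of at most [e / n] times the norm of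
    [h]. *)
Lemma C1_differentiable f p :
  (forall j, \forall x \near p, derivable f x (e_ j)) ->
  (forall j, {for p, continuous (partial j f)}) ->
  is_diff p f (rowdot (\row_j partial j f p)).
Proof.
move=> df cf; set D := \row_j _.
pose V : normedModType R := 'rV[R]_n.
pose g : V -> R^o := f; pose L : {linear V -> R^o} := rowdot D.
suff H (e : {posnum R}) : \forall h \near (0 : V),
    `|f (h + p) - (f p + rowdot D h)| <= e%:num * `|h|.
  have dE : 'd g p = L :> (V -> R^o).
    apply: diff_unique; first exact: rowdot_continuous.
    by apply/eqaddoP => _ /posnumP[e]; exact: H.
  split=> //; apply/diff_locallyP; rewrite dE; split; first exact: rowdot_continuous.
  by apply/eqaddoP => _ /posnumP[e]; exact: H.
(* In dimension zero [e / n] is [0] by convention, hence no admissible tolerance. *)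
have [N0|n0] := posnP n.
  have h0 (h : V) : h = 0 by apply/rowP => -[j jn]; exfalso; rewrite N0 in jn.
  near=> h; rewrite (h0 h) add0r linear0 addr0 subrr normr0.
  by rewrite mulr_ge0.
have e'0 : 0 < e%:num / n%:R :> R by rewrite divr_gt0// ltr0n.
have /nbhs_normP [d /= d0 H] : \forall x \near p, forall j, derivable f x (e_ j) /\
    `|partial j f x - partial j f p| <= e%:num / n%:R.
  apply: (@filter_forall _ _ _ (nbhs p) _) => j; apply: filterI; first exact: df.
  by move/cvgrPdist_le : (cf j) => /(_ _ e'0); apply: filterS => x; rewrite distrC.
apply/nbhs_normP; exists d => // h /=; rewrite sub0r normrN => hd.
have -> : f (h + p) - (f p + rowdot D h) =
   \sum_(j < n) (f (p + prefix_row j.+1 h) - f (p + prefix_row j h) - partial j f p * h ord0 j).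
  rewrite big_split /= -(big_mkord xpredT (fun j => f (p + prefix_row j.+1 h) - f (p + prefix_row j h))).
  rewrite telescope_sumr// prefix_row0 prefix_row_full addr0 sumrN opprD addrA [h + p]addrC.
  congr (_ - _ - _); apply: eq_bigr => j _; by rewrite mxE mulrC.
apply: (le_trans (ler_norm_sum _ _ _)).
have -> : e%:num * `|h| = \sum_(j < n) (e%:num / n%:R * `|h|).
  rewrite sumr_const card_ord -mulr_natr; field.
  by rewrite pnatr_eq0 -lt0n.
apply: ler_sum => j _.
have near_p (s : R) : `|s| <= `|h ord0 j| -> `|p - (p + prefix_row j h + s *: e_ j)| < d.
  move=> sh; apply: le_lt_trans hd; rewrite -addrA opprD addrA subrr add0r normrN.
  apply: rV_norm_le => // i; rewrite !mxE eqxx /=.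
  have [->|ij] := eqVneq i j.
    by rewrite ltnn mulr1 add0r (le_trans sh)// coord_norm_le.
  by rewrite mulr0 addr0; case: ifP => _; rewrite ?normr0 ?coord_norm_le.
have [s sh E] := @coord_MVT f (p + prefix_row j h) j (h ord0 j)
   (fun s sh => (H _ (near_p s sh) j).1).
rewrite prefix_rowS addrA E -mulrBl normrM ler_pM ?coord_norm_le//.
exact: (H _ (near_p s sh) j).2.
Unshelve. all: by end_near. Qed.

End C1.

(** * Laplacians along the coordinate axes *)

Lemma is_derive_sumR (R : realType) (n : nat) (h : 'I_n -> R -> R) (dh : 'I_n -> R) (t : R) :
  (forall j, is_derive t (1:R) (h j) (dh j)) ->
  is_derive t (1:R) (fun s => \sum_j h j s) (\sum_j dh j).
Proof.
move=> H; have -> : (fun s => \sum_j h j s) = \sum_j h j by rewrite fct_sumE.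
exact: is_derive_sum.
Qed.

Lemma sum_mul_delta (R : realType) (n : nat) (c : 'I_n -> R) (j : 'I_n) :
  \sum_i c i * (j == i)%:R = c j.
Proof.
rewrite (bigD1 j)//= eqxx mulr1 big1 ?addr0// => i ij.
by rewrite eq_sym (negbTE ij) mulr0.
Qed.

Lemma sum_mul_deltaC (R : realType) (n : nat) (c : 'I_n -> R) (j : 'I_n) :
  \sum_i c i * (i == j)%:R = c j.
Proof. by under eq_bigr do rewrite eq_sym; exact: sum_mul_delta. Qed.

Section curves.
Context {R : realType} {n : nat}.
Implicit Types (f : 'rV[R]_n -> R) (x y p q h : 'rV[R]_n) (z : R -> 'rV[R]_n).
Implicit Types (A : set 'rV[R]_n).

Local Notation e_ j := (delta_mx ord0 j : 'rV[R]_n).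

Lemma C1_curve f z t (dz : 'I_n -> R) :
  (forall j, \forall x \near z t, derivable f x (e_ j)) ->
  (forall j, {for z t, continuous (partial j f)}) ->
  (forall j, is_derive t (1:R) (fun s => z s ord0 j) (dz j)) ->
  is_derive t (1:R) (fun s => f (z s)) (\sum_j partial j f (z t) * dz j).
Proof.
move=> df cf dzj.
have dz1 : derivable z t 1.
  by apply/derivable_mxP => i j; rewrite ord1; case: (dzj j).
have Dz : 'D_1 z t = \row_j dz j.
  rewrite derive_mx//; apply/rowP => j; rewrite !mxE.
  by case: (dzj j).
have [dfz dfE] := C1_differentiable df cf.
have dzd : differentiable z t by apply/derivable1_diffP.
have dfzd : differentiable (f \o z) t by exact: differentiable_comp.
split; first exact/derivable1_diffP.
rewrite -[fun s => f (z s)]/(f \o z) deriveE// diff_comp// dfE /= -deriveE// Dz.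
by apply: eq_bigr => j _; rewrite !mxE mulrC.
Qed.

Lemma Ck1_near f A p j : open A -> Ck 1 A f -> A p ->
  (\forall x \near p, derivable f x (e_ j)) /\ {for p, continuous (partial j f)}.
Proof.
move=> oA [_ H] Ap; have [df [cf _]] := H j; split; last exact: cf.
by have := open_nbhs_nbhs (conj oA Ap); apply: filterS => x; exact: df.
Qed.

Lemma jet2_C2 f A z t (a b : 'I_n -> R) : open A -> Ck 2 A f -> A (z t) ->
  (forall j, jet2 (fun s => z s ord0 j) t (a j) (b j)) ->
  jet2 (fun s => f (z s)) t (\sum_j partial j f (z t) * a j)
    (\sum_j ((\sum_i partial i (partial j f) (z t) * a i) * a j + partial j f (z t) * b j)).
Proof.
move=> oA f2 Az jz.
have f1 : Ck 1 A f by case: f2 => ? H; split => // i; have [? [? _]] := H i.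
have pf1 j : Ck 1 A (partial j f) by case: f2 => _ /(_ j) [].
pose z1 j := sval (cid (jz j)).
have z1P j : [/\ \forall s \near t, is_derive s (1:R) (fun s => z s ord0 j) (z1 j s),
    z1 j t = a j & is_derive t (1:R) (z1 j) (b j)] := svalP (cid (jz j)).
exists (fun s => \sum_j partial j f (z s) * z1 j s); split.
- have zA : \forall s \near t, A (z s).
    have zt : z @ t --> z t.
      apply: differentiable_continuous; apply/derivable1_diffP.
      apply/derivable_mxP => i j; rewrite ord1.
      by case: (jet2_is_derive (jz j)).
    exact: (zt _ (open_nbhs_nbhs (conj oA Az))).
  have dz : \forall s \near t, forall j, is_derive s (1:R) (fun s => z s ord0 j) (z1 j s).
    by apply: (@filter_forall _ _ _ (nbhs t) _) => j; have [] := z1P j.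
  apply: filterS2 zA dz => s As dzs.
  by apply: C1_curve dzs => j; have [] := Ck1_near j oA f1 As.
- by apply: eq_bigr => j _; have [_ -> _] := z1P j.
- apply: is_derive_sumR => j; have [_ z1t dz1] := z1P j.
  have dp : is_derive t (1:R) (fun s => partial j f (z s))
      (\sum_i partial i (partial j f) (z t) * a i).
    apply: C1_curve => i; last exact: jet2_is_derive (jz i).
      by have [] := Ck1_near i oA (pf1 j) Az.
    by have [] := Ck1_near i oA (pf1 j) Az.
  apply: (is_derive_eq (is_deriveM dp dz1)).
  by rewrite /GRing.scale /= z1t; ring.
Qed.

(** The Laplacian as a relation read off the jets along the coordinate lines: powers of the distance
    and Kelvin transforms obtain one without first being shown to be [Ck 2]. *)
Definition lap_at f y L := exists d1 d2 : 'I_n -> R,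
  (forall i, jet2 (fun t => f (y + t *: e_ i)) 0 (d1 i) (d2 i)) /\ L = \sum_i d2 i.

Lemma lap_atD f g y L M : lap_at f y L -> lap_at g y M -> lap_at (fun x => f x + g x) y (L + M).
Proof.
move=> [a [b [jf ->]]] [c [d [jg ->]]]; exists (fun i => a i + c i), (fun i => b i + d i).
by split=> [i|]; [exact: jet2D|rewrite big_split].
Qed.

Lemma lap_atZ (c : R) f y L : lap_at f y L -> lap_at (fun x => c * f x) y (c * L).
Proof.
move=> [a [b [jf ->]]]; exists (fun i => c * a i), (fun i => c * b i).
by split=> [i|]; [exact: jet2Zl|rewrite mulr_sumr].
Qed.

Lemma line_cvg y i : y + t *: e_ i @[t --> (0 : R)] --> y.
Proof.
rewrite -[X in _ --> X]addr0 -[X in _ + X](scale0r (e_ i)).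
by apply: cvgD; [exact: cvg_cst|apply: cvgZr_tmp; exact: cvg_id].
Qed.

Lemma lap_at_min f y L : (\forall x \near y, f y <= f x) -> lap_at f y L -> 0 <= L.
Proof.
move=> fy [a [b [jf ->]]]; apply: sumr_ge0 => i _.
apply: jet2_min (jf i); rewrite scale0r addr0.
exact: (@line_cvg y i _ fy).
Qed.

Lemma lap_at_C2 f A y : open A -> Ck 2 A f -> A y -> lap_at f y (laplacian f y).
Proof.
move=> oA f2 Ay.
have jl (i j : 'I_n) : jet2 (fun t => (y + t *: e_ i) ord0 j) 0 (j == i)%:R 0.
  have := jet2D (jet2_cst (y ord0 j) 0) (jet2M (jet2_id 0) (jet2_cst (j == i)%:R 0)).
  rewrite !(mul0r, mulr0, add0r, addr0, mul1r) /cst; apply: jet2_near_eq.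
  by near=> t; rewrite !mxE eqxx.
have y0 i : y + (0:R) *: e_ i = y by rewrite scale0r addr0.
have j2 i := @jet2_C2 f A (fun t => y + t *: e_ i) 0 _ _ oA f2 _ (jl i).
exists (fun i => partial i f y), (fun i => partial i (partial i f) y); split=> [i|//].
have := j2 _ i; rewrite !y0 => /(_ (fun i => eq_ind_r A Ay (y0 i))).
rewrite sum_mul_deltaC; under eq_bigr do rewrite mulr0 addr0.
by rewrite !sum_mul_deltaC.
Unshelve. all: by end_near. Qed.

End curves.

(** * The Laplacian of a Kelvin transform *)

Lemma jet2M_val (R : realType) (f g : R -> R) (t a b c d p q : R) : f t = p -> g t = q ->
  jet2 f t a b -> jet2 g t c d ->
  jet2 (fun s => f s * g s) t (a * q + p * c) (b * q + 2 * (a * c) + p * d).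
Proof. by move=> <- <-; exact: jet2M. Qed.

Section sqn.
Context {R : realType} {n : nat}.
Implicit Types (f : 'rV[R]_n -> R) (x y p q h : 'rV[R]_n).

Local Notation e_ j := (delta_mx ord0 j : 'rV[R]_n).

Definition sqn x : R := \sum_i x ord0 i ^+ 2.

Lemma sqn_ge0 x : 0 <= sqn x.
Proof. by apply: sumr_ge0 => i _; exact: sqr_ge0. Qed.

Lemma sqn_eq0 x : (sqn x == 0) = (x == 0).
Proof.
apply/eqP/eqP => [s0|->]; last by apply: big1 => i _; rewrite mxE expr0n.
apply/rowP => i; rewrite mxE; apply/eqP; rewrite -sqrf_eq0; apply/eqP.
by move/psumr_eq0P : s0 => ->// j _; exact: sqr_ge0.
Qed.

Lemma sqn_gt0 x : (0 < sqn x) = (x != 0).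
Proof. by rewrite lt0r sqn_eq0 sqn_ge0 andbT. Qed.

Lemma sqn0 : sqn 0 = 0.
Proof. by apply/eqP; rewrite sqn_eq0. Qed.

Lemma sqnZ c x : sqn (c *: x) = c ^+ 2 * sqn x.
Proof. by rewrite mulr_sumr; apply: eq_bigr => i _; rewrite mxE exprMn. Qed.

Lemma sqnN x : sqn (- x) = sqn x.
Proof. by rewrite -scaleN1r sqnZ sqrrN expr1n mul1r. Qed.

Lemma sqn_continuous : continuous sqn.
Proof.
move=> x; apply: (@cvg_sumR R _ (nbhs x)) => i.
have c := @coord_continuous R 1 n ord0 i x.
exact: (cvgM c c).
Qed.

Lemma subr_continuous x : continuous (fun y => y - x).
Proof. by move=> y; apply: (@cvgB R _ _ (nbhs y) _ id (cst x)); [exact: cvg_id|exact: cvg_cst]. Qed.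

Lemma sqnB_continuous x : continuous (fun y => sqn (y - x)).
Proof. by move=> y; exact: (cvg_comp _ _ (@subr_continuous x y) (@sqn_continuous (y - x))). Qed.

Lemma sqn_line y i t : sqn (y + t *: e_ i) = sqn y + 2 * y ord0 i * t + t ^+ 2.
Proof.
rewrite /sqn (bigD1 i)//= [in RHS](bigD1 i)//= !mxE !eqxx mulr1.
have -> : \sum_(j < n | j != i) (y + t *: e_ i) ord0 j ^+ 2 = \sum_(j < n | j != i) y ord0 j ^+ 2.
  by apply: eq_bigr => j ji; rewrite !mxE (negbTE ji) andbF mulr0 addr0.
by ring.
Qed.

Lemma sqn_norm_ge y : `|y| ^+ 2 <= sqn y.
Proof.
have H j : `|y ord0 j| ^+ 2 <= sqn y.
  rewrite real_normK ?num_real// /sqn (bigD1 j)//= lerDl.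
  by apply: sumr_ge0 => i _; exact: sqr_ge0.
rewrite -[leRHS]sqr_sqrtr ?sqn_ge0// ler_pXn2r ?nnegrE ?sqrtr_ge0//.
apply: rV_norm_le => [|j]; first exact: sqrtr_ge0.
by rewrite -sqrtr_sqr ler_wsqrtr// -real_normK ?num_real.
Qed.

Lemma sqnB_le x y : sqn (x - y) <= 2 * sqn x + 2 * sqn y.
Proof.
rewrite !mulr_sumr -big_split; apply: ler_sum => i _ /=; rewrite !mxE.
by have := sqr_ge0 (x ord0 i + y ord0 i); nra.
Qed.

(* The dilation factor of the inversion in the sphere of center x and squared radius l. *)
Definition invfac (x : 'rV[R]_n) (l : R) y : R := l / sqn (y - x).

(** [invfac] is the square of radius over distance, so the classical weight (r / |y - x|)^(n - 2)
    has half that exponent here. *)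
Definition kelvin x l m f y : R := invfac x l y `^ m * f (x + invfac x l y *: (y - x)).

Lemma invfac_gt0 x l y : 0 < l -> y != x -> 0 < invfac x l y.
Proof. by move=> l0 yx; rewrite divr_gt0// sqn_gt0 subr_eq0. Qed.

(* The Kelvin transform proper is m = (n - 2) / 2, where the second term vanishes; f = 1 gives
   the Laplacian of a power of the distance to x. *)
Lemma lap_at_kelvin x l m f A y : 0 < l -> y != x ->
  let s := invfac x l y in let z := x + s *: (y - x) in
  open A -> Ck 2 A f -> A z ->
  lap_at (kelvin x l m f) y
    (s `^ m * (s ^+ 2 * laplacian f z + (4 * m + 4 - 2 * n%:R) / l * s *
      (m * f z + s * \sum_j partial j f z * (y - x) ord0 j))).
Proof.
move=> l0 yx s z oA f2 Az.
have s0 : 0 < s by exact: invfac_gt0.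
set Y := y - x.
have q0 : 0 < sqn Y by rewrite sqn_gt0 subr_eq0.
have qE : sqn Y = l / s by rewrite /s /invfac -/Y; field; lra.
(* First and second derivatives of [invfac] along [e_ i], with the squared length of [Y] eliminated
   in favour of [l / s]. *)
pose a i : R := - 2 * s ^+ 2 * Y ord0 i / l.
pose b i : R := 8 * s ^+ 3 * Y ord0 i ^+ 2 / l ^+ 2 - 2 * s ^+ 2 / l.
have jrho i : jet2 (fun t => sqn (y + t *: e_ i - x)) 0 (2 * Y ord0 i) 2.
  have := jet2D (jet2D (jet2_cst (sqn Y) 0) (jet2Zl (2 * Y ord0 i) (jet2_id 0)))
     (jet2M (jet2_id 0) (jet2_id 0)).
  rewrite /= !(mul0r, mulr0, add0r, addr0, mulr1); apply: jet2_near_eq.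
  by near=> t; rewrite [y + _ - x]addrAC sqn_line expr2.
have rho0 i : sqn (y + (0:R) *: e_ i - x) = sqn Y by rewrite scale0r addr0.
have js i : jet2 (fun t => invfac x l (y + t *: e_ i)) 0 (a i) (b i).
  have := jet2Zl l (jet2V _ (jrho i)); rewrite rho0 => /(_ (lt0r_neq0 q0)).
  congr jet2; rewrite /a /b qE; field; by rewrite !gt_eqF.
have s00 i : invfac x l (y + (0:R) *: e_ i) = s by rewrite scale0r addr0.
have jp i : jet2 (fun t => invfac x l (y + t *: e_ i) `^ m) 0
    (m * (s `^ m / s) * a i) (m * (m - 1) * (s `^ m / s ^+ 2) * a i ^+ 2 + m * (s `^ m / s) * b i).
  have := jet2_powR m _ (js i); rewrite s00 => /(_ s0).
  have sN0 : s != 0 by rewrite gt_eqF.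
  by rewrite !powRB ?sN0 ?implybT// powRr1 ?(ltW s0)// (@powR_mulrn _ s 2 (ltW s0)).
have jz i j : jet2 (fun t => (x + invfac x l (y + t *: e_ i) *: (y + t *: e_ i - x)) ord0 j) 0
    (a i * Y ord0 j + s * (j == i)%:R) (b i * Y ord0 j + 2 * a i * (j == i)%:R).
  have jY : jet2 (fun t => Y ord0 j + (j == i)%:R * t) 0 (j == i)%:R 0.
    have := jet2D (jet2_cst (Y ord0 j) 0) (jet2Zl (j == i)%:R (jet2_id 0)).
    by rewrite !(add0r, mulr0, mulr1).
  have := jet2D (jet2_cst (x ord0 j) 0) (jet2M (js i) jY).
  rewrite s00 !(add0r, mulr0, addr0) mulrA; apply: jet2_near_eq.
  by near=> t; rewrite /Y !mxE eqxx /=; congr (_ + _ * _); ring.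
have z00 i : x + invfac x l (y + (0:R) *: e_ i) *: (y + (0:R) *: e_ i - x) = z.
  by rewrite scale0r addr0.
have jf i := @jet2_C2 R n f A
  (fun t => x + invfac x l (y + t *: e_ i) *: (y + t *: e_ i - x)) 0 _ _ oA f2
  (eq_ind_r A Az (z00 i)) (jz i).
set P := s `^ m.
pose D j := partial j f z; pose H i j := partial i (partial j f) z.
(* [z1 i j] and [z2 i j] are the first and second derivatives along [e_ i] of the coordinate [j] of
   the reflected point; [d1] and [d2] are those of the transform. *)
pose z1 i j := a i * Y ord0 j + s * (j == i)%:R.
pose z2 i j := b i * Y ord0 j + 2 * a i * (j == i)%:R.
pose d1 i := m * (P / s) * a i * f z + P * \sum_j D j * z1 i j.
pose d2 i := (m * (m - 1) * (P / s ^+ 2) * a i ^+ 2 + m * (P / s) * b i) * f z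
  + 2 * (m * (P / s) * a i * \sum_j D j * z1 i j)
  + P * \sum_j ((\sum_k H k j * z1 i k) * z1 i j + D j * z2 i j).
have jf' i : jet2 (fun t => f (x + invfac x l (y + t *: e_ i) *: (y + t *: e_ i - x))) 0
    (\sum_j D j * z1 i j) (\sum_j ((\sum_k H k j * z1 i k) * z1 i j + D j * z2 i j)).
  by have := jf i; rewrite z00.
exists d1, d2; split.
  move=> i.
  have Ep : invfac x l (y + (0:R) *: e_ i) `^ m = P by rewrite s00.
  have Ef := congr1 f (z00 i).
  exact: (jet2M_val (f := fun t => invfac x l (y + t *: e_ i) `^ m)
    (g := fun t => f (x + invfac x l (y + t *: e_ i) *: (y + t *: e_ i - x))) Ep Ef (jp i) (jf' i)).
have sa : \sum_i a i ^+ 2 = 4 * s ^+ 3 / l.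
  have -> : 4 * s ^+ 3 / l = 4 * s ^+ 4 / l ^+ 2 * sqn Y by rewrite qE; field; lra.
  by rewrite mulr_sumr; apply: eq_bigr => i _; rewrite /a; field; lra.
have sb : \sum_i b i = (8 - 2 * n%:R) * s ^+ 2 / l.
  rewrite big_split /= -mulr_suml -mulr_sumr -/(sqn Y) qE sumr_const card_ord.
  by rewrite -[_ *+ n]mulr_natr; field; lra.
have saz j : \sum_i a i * z1 i j = 4 * s ^+ 3 / l * Y ord0 j + s * a j.
  rewrite -sa mulr_suml -(sum_mul_delta a j) mulr_sumr -big_split; apply: eq_bigr => i _.
  by rewrite /z1 /=; ring.
(* Inversion is conformal: its Jacobian [z1] is [s] times an orthogonal matrix, so the Hessian of
   [f] contracts to [s ^+ 2] times the Laplacian. *)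
have szz j k : \sum_i z1 i k * z1 i j = s ^+ 2 * (k == j)%:R.
  transitivity (\sum_i (a i * z1 i j * Y ord0 k + s * (a i * Y ord0 j + s * (j == i)%:R) * (k == i)%:R)).
    by apply: eq_bigr => i _; rewrite /z1; ring.
  rewrite big_split /= -mulr_suml saz sum_mul_delta (eq_sym j) /a.
  by field; lra.
have sz2 j : \sum_i z2 i j = (8 - 2 * n%:R) * s ^+ 2 / l * Y ord0 j + 2 * a j.
  rewrite big_split /= -mulr_suml sb; congr (_ + _).
  exact: (sum_mul_delta (fun i => 2 * a i)).
rewrite /d2 big_split big_split /= -mulr_suml big_split /= -mulr_sumr -mulr_sumr sa sb.
have -> : \sum_i 2 * (m * (P / s) * a i * \sum_j D j * z1 i j) =
    2 * m * (P / s) * \sum_j D j * (4 * s ^+ 3 / l * Y ord0 j + s * a j).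
  rewrite mulr_sumr; under eq_bigr do rewrite !mulr_sumr.
  rewrite exchange_big; apply: eq_bigr => j _ /=.
  by rewrite -saz !mulr_sumr; apply: eq_bigr => i _; ring.
rewrite -mulr_sumr.
have -> : \sum_i \sum_j ((\sum_k H k j * z1 i k) * z1 i j + D j * z2 i j) =
    s ^+ 2 * laplacian f z + \sum_j D j * ((8 - 2 * n%:R) * s ^+ 2 / l * Y ord0 j + 2 * a j).
  rewrite exchange_big /= mulr_sumr -big_split; apply: eq_bigr => j _ /=.
  rewrite big_split /= -mulr_sumr sz2; congr (_ + _).
  under eq_bigr do rewrite mulr_suml.
  rewrite exchange_big /= -[partial j (partial j f) z]/(H j j).
  transitivity (\sum_k s ^+ 2 * H k j * (k == j)%:R); last exact: sum_mul_deltaC.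
  apply: eq_bigr => k _; rewrite -mulrA [H k j * _]mulrC mulrA -szz mulr_suml.
  by apply: eq_bigr => i _; ring.
have DY c : \sum_j D j * (c * Y ord0 j + s * a j) = (c - 2 * s ^+ 3 / l) * \sum_j D j * Y ord0 j.
  by rewrite mulr_sumr; apply: eq_bigr => j _; rewrite /a; field; lra.
have DY2 c : \sum_j D j * (c * Y ord0 j + 2 * a j) = (c - 4 * s ^+ 2 / l) * \sum_j D j * Y ord0 j.
  by rewrite mulr_sumr; apply: eq_bigr => j _; rewrite /a; field; lra.
rewrite DY DY2; set S := \sum_j _.
by field; rewrite !gt_eqF.
Unshelve. all: by end_near. Qed.
End sqn.

(** * A weak minimum principle on punctured closed sets *)

Section minimum.
Context {R : realType} {n : nat}.
Implicit Types (f g w H : 'rV[R]_n -> R) (x y p q : 'rV[R]_n) (C E A : set 'rV[R]_n).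

Lemma Ck_cst (k : nat) A (c : R) : Ck k A (cst c : 'rV[R]_n -> R).
Proof.
elim: k c => [|k ih] c; first by split => // x _; exact: cst_continuous.
split=> [x _|i]; first exact: cst_continuous.
split=> [x _|]; first exact: derivable_cst.
have -> : partial i (cst c : 'rV[R]_n -> R) = cst 0; last exact: ih.
by apply/funext => x; exact: derive_cst.
Qed.

Lemma lap_at_pow x (l m : R) y : 0 < l -> y != x ->
  lap_at (fun z => invfac x l z `^ m) y
    (invfac x l y `^ m * ((4 * m + 4 - 2 * n%:R) / l * invfac x l y * m)).
Proof.
move=> l0 yx.
have part0 i : partial i (cst 1 : 'rV[R]_n -> R) = cst 0.
  by apply/funext => z; exact: derive_cst.
have lap0 z : laplacian (cst 1 : 'rV[R]_n -> R) z = 0.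
  by apply: big1 => i _; rewrite part0; exact: derive_cst.
have := @lap_at_kelvin R n x l m (cst 1) setT y l0 yx openT (Ck_cst 2 _ 1) I.
rewrite lap0 big1 => [|i _]; last by rewrite part0 mul0r.
rewrite !mulr0 add0r addr0 mulr1 /kelvin.
by under eq_fun do rewrite mulr1.
Qed.

Lemma invfac_continuous x l y : y != x -> {for y, continuous (invfac x l)}.
Proof.
move=> yx; have q0 : sqn (y - x) != 0 by rewrite sqn_eq0 subr_eq0.
exact: (cvgMl_tmp (a := l) (cvgV q0 (@sqnB_continuous R n x y))).
Qed.

Lemma powR_continuous (m a : R) : 0 < a -> {for a, continuous (fun t : R => t `^ m)}.
Proof.
move=> a0; apply: differentiable_continuous; apply/derivable1_diffP.
by case: (is_derive1_powR m a0).
Qed.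

Lemma invfac_pow_continuous x l m y : 0 < l -> y != x ->
  {for y, continuous (fun z => invfac x l z `^ m)}.
Proof.
move=> l0 yx; have c := @invfac_continuous x l y yx.
exact: (cvg_comp _ _ c (@powR_continuous m _ (invfac_gt0 l0 yx))).
Qed.

Lemma invfac_pow_near0 (m B : R) : 0 < m ->
  \forall y \near (0 : 'rV[R]_n), y != 0 -> B <= invfac 0 1 y `^ m.
Proof.
move=> m0; pose B' := Num.max B 1.
have B0 : 0 < B' by rewrite lt_max ltr01 orbT.
have e0 : 0 < (B' `^ m^-1)^-1 by rewrite invr_gt0 powR_gt0.
have : \forall y \near (0 : 'rV[R]_n), sqn y < (B' `^ m^-1)^-1.
  by have := @sqn_continuous R n 0 => /cvgr_lt; rewrite sqn0; exact.
apply: filterS => y ye y0; apply: (@le_trans _ _ B'); first by rewrite le_max lexx.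
have -> : B' = (B' `^ m^-1) `^ m by rewrite -powRrM mulVf ?powRr1 ?ltW// gt_eqF.
have sq0 : 0 < sqn y by rewrite sqn_gt0.
have [v0 w0] : 0 < (sqn y)^-1 /\ 0 < B' `^ m^-1 by rewrite invr_gt0 powR_gt0.
rewrite /invfac subr0 div1r; apply: ge0_ler_powR; [exact: ltW|exact: ltW|exact: ltW|].
by rewrite -[leLHS]invrK lef_pV2 ?posrE// ltW.
Qed.

Lemma open_punctured : open (punctured R n).
Proof.
have -> : punctured R n = @sqn R n @^-1` [set t | 0 < t].
  by apply/seteqP; split => y /=; rewrite sqn_gt0.
by apply: open_comp; [move=> y _; exact: sqn_continuous|exact: open_gt].
Qed.

Lemma closed_ge_continuous (f : 'rV[R]_n -> R) (a : R) : continuous f -> closed [set y | a <= f y].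
Proof. by move=> cf; apply: (closed_comp _ (@closed_ge R a)) => y _; exact: cf. Qed.

Lemma closed_le_continuous (f : 'rV[R]_n -> R) (a : R) : continuous f -> closed [set y | f y <= a].
Proof. by move=> cf; apply: (closed_comp _ (@closed_le R a)) => y _; exact: cf. Qed.

Lemma compact_norm_shell C (a b : R) : closed C ->
  compact (C `&` [set y | a <= `|y|] `&` [set y | `|y| <= b]).
Proof.
move=> cC; apply: bounded_closed_compact.
  exists b; split; first exact: num_real.
  by move=> M bM y [_ /= yb]; apply: le_trans yb (ltW bM).
apply: closedI; last exact: closed_le_continuous (@norm_continuous _ _).
by apply: closedI => //; exact: closed_ge_continuous (@norm_continuous _ _).
Qed.

(* A multiple of |y|^(- (n - 2) / 2) is added to f: it is strictly superharmonic and tends to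
   infinity at the origin, where no boundary condition is imposed. *)
Lemma weak_min C f : (3 <= n)%N -> closed C ->
  (forall y, C y -> y != 0 -> {for y, continuous f}) ->
  (exists M : R, \forall y \near (0 : 'rV[R]_n), C y -> y != 0 -> - M <= f y) ->
  (forall e : R, 0 < e -> exists r : R, forall y, C y -> r < `|y| -> - e <= f y) ->
  (forall y, C y -> y != 0 -> f y < 0 ->
    (\forall z \near y, C z) /\ exists2 L, lap_at f y L & L <= 0) ->
  forall y, C y -> y != 0 -> 0 <= f y.
Proof.
move=> n3 cC cf [M f0] foo lf y1 Cy1 y10; rewrite leNgt; apply/negP => fy1.
have n3' : 3 <= n%:R :> R by rewrite (ler_nat R 3).
(* Half the harmonic exponent: the factor [4 * m + 4 - 2 * n%:R] of [lap_at_pow] becomes [2 - n%:R],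
   which is negative. *)
pose m : R := (n%:R - 2) / 4; have m0 : 0 < m by rewrite /m; lra.
pose s y := @invfac R n 0 1 y `^ m.
have s_ge0 y : 0 <= s y by exact: powR_ge0.
have s1 : 0 < s y1 by rewrite powR_gt0// invfac_gt0.
(* [eta] is such that the perturbation only halves the negative value at [y1], to [- (2 * mu)].
   Points of [C] off the origin with [g] below [- mu] lie in the compact shell [K]; the gap between
   the two levels makes the minimum over [K] a genuine local minimum. *)
pose eta := - f y1 / (2 * s y1).
have eta0 : 0 < eta by rewrite divr_gt0//; lra.
pose mu := - f y1 / 4; have mu0 : 0 < mu by rewrite /mu; lra.
pose g y := f y + eta * s y.
have gy1 : g y1 = - (2 * mu) by rewrite /g /eta /mu; field; rewrite gt_eqF.
have /nbhs_normP [d /= d0 gd] : \forall y \near (0 : 'rV[R]_n), C y -> y != 0 -> 0 <= g y.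
  apply: filterS2 f0 (invfac_pow_near0 (M / eta) m0) => y fy sy Cy y0.
  have := fy Cy y0; have := sy y0; rewrite -/(s y) ler_pdivrMr// /g; lra.
have [r foor] := foo mu mu0.
pose K := C `&` [set y | d <= `|y|] `&` [set y | `|y| <= r].
have KE y : C y -> y != 0 -> g y < - mu -> K y.
  move=> Cy y0 gy; split; first split => //=.
    rewrite leNgt; apply/negP => yd; have := gd y; rewrite /= sub0r normrN.
    by move=> /(_ yd Cy y0); lra.
  rewrite /= leNgt; apply/negP => ry; have := foor y Cy ry.
  by have := mulr_ge0 (ltW eta0) (s_ge0 y); move: gy; rewrite /g; lra.
have Ky1 : K y1 by apply: KE => //; lra.
have K0 y : K y -> C y /\ y != 0.
  by move=> [[Cy /= dy] _]; split=> //; rewrite -normr_gt0 (lt_le_trans d0).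
have cg y : C y -> y != 0 -> {for y, continuous g}.
  move=> Cy y0; have c2 := @invfac_pow_continuous 0 1 m y ltr01 y0.
  exact: (cvgD (cf y Cy y0) (cvgMl_tmp (a := eta) c2)).
have [|||c Kc minc] := @EVT_min_rV R n g K.
- by exists y1.
- exact: compact_norm_shell.
- by apply: continuous_in_subspaceT => y /set_mem /K0[Cy y0]; exact: cg.
move/set_mem : Kc => Kc; have [Cc c0] := K0 _ Kc.
have gc : g c <= - (2 * mu) by rewrite -gy1; apply: minc; exact/mem_set.
have fc : f c < 0.
  by have := mulr_ge0 (ltW eta0) (s_ge0 c); move: gc; rewrite /g; lra.
have [Cnear [L lfc L0]] := lf c Cc c0 fc.
have ls : lap_at s c (invfac 0 1 c `^ m * ((4 * m + 4 - 2 * n%:R) / 1 * invfac 0 1 c * m)).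
  exact: lap_at_pow.
have lg := lap_atD lfc (lap_atZ eta ls).
have gmin : \forall x \near c, g c <= g x.
  have neq0 : \forall x \near c, x != 0.
    exact: open_nbhs_nbhs (conj open_punctured c0).
  apply: filterS2 Cnear neq0 => x Cx x0.
  have [gx|gx] := ltP (g x) (- mu); last by lra.
  by apply: minc; apply/mem_set; exact: KE.
have := lap_at_min gmin lg.
set Ls := _ * (_ * m); have : Ls < 0.
  have i0 : 0 < @invfac R n 0 1 c by rewrite invfac_gt0.
  rewrite pmulr_rlt0 ?powR_gt0// divr1 nmulr_rlt0// nmulr_rlt0//.
  by rewrite /m; lra.
by move=> Ls0; nra.
Qed.

End minimum.

(** * Lower bounds by Green functions *)

Section pole.
Context {R : realType} {n : nat}.
Implicit Types (f g w u H : 'rV[R]_n -> R) (x y p q : 'rV[R]_n) (C E A : set 'rV[R]_n).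
Implicit Types (l rho m k : R).

Lemma powR_le k (a b : R) : 0 <= k -> 0 <= a -> a <= b -> a `^ k <= b `^ k.
Proof.
by move=> k0 a0 ab; apply: ge0_ler_powR => //; rewrite nnegrE// (le_trans a0).
Qed.

Lemma invfac_pow_infty p k e : 0 < k -> 0 < e ->
  exists r : R, forall y, r < `|y| -> invfac p 1 y `^ k <= e.
Proof.
move=> k0 e0; pose T := 1 + e `^ (- k^-1).
have T1 : 1 <= T by rewrite lerDl powR_ge0.
exists (`|p| + T) => y ry.
have Ty : T <= `|y - p| by have := ler_normB y (- p); have := lerB_dist y p; lra.
have Tq : T <= sqn (y - p).
  by apply: le_trans (sqn_norm_ge _); rewrite expr2; nra.
have -> : e = (e `^ k^-1) `^ k by rewrite -powRrM mulVf ?powRr1 ?(ltW e0)// gt_eqF.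
apply: powR_le; [exact: ltW|by rewrite divr_ge0// sqn_ge0|].
rewrite /invfac div1r -[leRHS]invrK -powRN lef_pV2 ?posrE ?powR_gt0//; try lra.
by apply: le_trans Tq; rewrite /T lerDr.
Qed.

Lemma near_sqn_gt x l y : l < sqn (y - x) -> \forall z \near y, l < sqn (z - x).
Proof. by move=> ly; exact: (cvgr_gt _ (@sqnB_continuous R n x y)). Qed.

Lemma closed_sqn_ge x l : closed [set y | l <= sqn (y - x)].
Proof. by apply: closed_ge_continuous; exact: sqnB_continuous. Qed.

(** [weak_min] for [w] minus a multiple of [H], on [E] without the ball of squared radius [rho]
    about [p]. There the multiple of [H] is at most [m], which settles the edge of the ball and the
    puncture, and it tends to 0 at infinity. In the last hypothesis the alternative [H y <= 0] takes
    care of the boundary of [E]. *)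
Lemma pole_lb k E w H p rho m : (3 <= n)%N -> 0 < k -> 0 < rho -> 0 < m -> closed E ->
  (forall y, E y -> y != 0 -> {for y, continuous w}) ->
  (forall y, E y -> y != 0 -> 0 <= w y) ->
  (forall y, E y -> y != 0 -> sqn (y - p) <= rho -> m <= w y) ->
  (forall y, E y -> y != p -> {for y, continuous H}) ->
  (forall y, E y -> y != p -> H y <= invfac p 1 y `^ k) ->
  (forall y, E y -> y != p -> lap_at H y 0) ->
  (forall y, E y -> y != 0 -> H y <= 0 \/
    (\forall z \near y, E z) /\ exists2 L, lap_at w y L & L <= 0) ->
  forall y, E y -> y != 0 -> rho <= sqn (y - p) -> m * rho `^ k * H y <= w y.
Proof.
move=> n3 k0 rho0 m0 cE cw w0 wm cH Hle lH Ebd y Ey y0 yrho.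
pose e := m * rho `^ k; have e0 : 0 < e by rewrite mulr_gt0// powR_gt0.
pose C := E `&` [set y | rho <= sqn (y - p)].
have Cp z : C z -> z != p.
  by move=> [_ /= rz]; apply/eqP => zp; move: rz; rewrite zp subrr sqn0; lra.
have Hrho z : C z -> H z <= rho `^ (- k).
  move=> Cz; apply: le_trans (Hle z Cz.1 (Cp z Cz)) _.
  case: Cz => _ /= rz.
  rewrite -mulN1r powRrM powR_inv1 ?(ltW rho0)//.
  apply: powR_le; [exact: ltW|by rewrite divr_ge0// sqn_ge0|].
  by rewrite /invfac div1r lef_pV2 ?posrE//; lra.
have eHrho z : C z -> e * H z <= m.
  move=> Cz; have := Hrho z Cz; rewrite powRN => h.
  rewrite /e -mulrA ger_pMr//; apply: le_trans (ler_wpM2l (powR_ge0 _ _) h) _.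
  by rewrite mulfV// gt_eqF// powR_gt0.
pose f z := w z + - e * H z.
suff : 0 <= f y by rewrite /f mulNr subr_ge0.
apply: (@weak_min R n C f n3) => //.
- by apply: closedI => //; exact: closed_sqn_ge.
- move=> z Cz z0.
  exact: (cvgD (cw z Cz.1 z0) (cvgMl_tmp (a := - e) (cH z Cz.1 (Cp z Cz)))).
- exists m; near=> z => Cz z0; rewrite /f.
  by have := w0 z Cz.1 z0; have := eHrho z Cz; lra.
- move=> d d0; have [r rP] := @invfac_pow_infty p k (d / e) k0 (divr_gt0 d0 e0).
  exists (Num.max r 0) => z Cz; rewrite gt_max => /andP[rz z0].
  have := w0 z Cz.1; rewrite -normr_gt0 => /(_ z0).
  have := le_trans (Hle z Cz.1 (Cp z Cz)) (rP z rz).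
  by rewrite ler_pdivlMr// /f; lra.
- move=> z Cz z0 fz.
  have [Enear [L lwL L0]] : (\forall z' \near z, E z') /\ exists2 L, lap_at w z L & L <= 0.
    case: (Ebd z Cz.1 z0) => // Hz; exfalso.
    by have := w0 z Cz.1 z0; move: fz; rewrite /f; nra.
  have rz : rho < sqn (z - p).
    rewrite ltNge; apply/negP => zr; have := wm z Cz.1 z0 zr.
    by have := eHrho z Cz; move: fz; rewrite /f; lra.
  split; first by apply: filterS2 Enear (near_sqn_gt rz) => z' ? /ltW.
  exists (L + - e * 0); last by rewrite mulr0 addr0.
  exact: lap_atD lwL (lap_atZ _ (lH z Cz.1 (Cp z Cz))).
Unshelve. all: by end_near. Qed.

Lemma near_sqn_ball x (P : 'rV[R]_n -> Prop) : (\forall y \near x, P y) ->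
  exists2 rho, 0 < rho & forall y, sqn (y - x) <= rho -> P y.
Proof.
move=> /nbhs_normP [e /= e0 eP]; exists ((e / 2) ^+ 2).
  by rewrite exprn_gt0// divr_gt0.
move=> y ye; apply: eP => /=; rewrite distrC; have := le_trans (sqn_norm_ge _) ye.
have e2 : 0 <= e / 2 by lra.
by rewrite ler_pXn2r ?nnegrE// => h; lra.
Qed.

Lemma gt_half_ball u p : {for p, continuous u} -> 0 < u p ->
  exists2 rho, 0 < rho & forall y, sqn (y - p) <= rho -> u p / 2 <= u y.
Proof.
move=> cu up; have up2 : u p / 2 < u p by lra.
apply: near_sqn_ball; have : \forall y \near p, u p / 2 < u y by exact: (cvgr_gt _ cu).
by apply: filterS => y /ltW.
Qed.

Definition superharmonic_off0 u := forall y, y != 0 -> exists2 L, lap_at u y L & L <= 0.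

(** [pole_lb] on the whole space, with the fundamental solution as [H]: a lower bound near one point
    spreads everywhere, with decay |y|^(2 - n). *)
Lemma superharmonic_ge_pole k u p rho m : (3 <= n)%N -> k = (n%:R - 2) / 2 -> 0 < rho -> 0 < m ->
  (forall y, y != 0 -> {for y, continuous u}) -> (forall y, y != 0 -> 0 <= u y) ->
  superharmonic_off0 u ->
  (forall y, y != 0 -> sqn (y - p) <= rho -> m <= u y) ->
  forall y, y != 0 -> rho <= sqn (y - p) -> m * rho `^ k * invfac p 1 y `^ k <= u y.
Proof.
move=> n3 kE rho0 m0 cu u0 lu um y y0 yr.
have n3' : 3 <= n%:R :> R by rewrite (ler_nat R 3).
have k0 : 0 < k by rewrite kE; lra.
apply: (@pole_lb k setT u (fun z => invfac p 1 z `^ k) p rho m n3 k0 rho0 m0) => //.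
- by move=> z _; exact: cu.
- by move=> z _; exact: u0.
- by move=> z _; exact: um.
- by move=> z _ zp; exact: invfac_pow_continuous.
- move=> z _ zp; have := @lap_at_pow R n p 1 k z ltr01 zp.
  suff -> : 4 * k + 4 - 2 * n%:R = 0 by rewrite !mul0r mulr0.
  by rewrite kE; field.
- by move=> z _ z0; right; split; [near=> z'|exact: lu].
Unshelve. all: by end_near. Qed.

Lemma superharmonic_gt0 u p x : (3 <= n)%N ->
  (forall y, y != 0 -> {for y, continuous u}) -> (forall y, y != 0 -> 0 <= u y) ->
  superharmonic_off0 u -> p != 0 -> 0 < u p -> x != 0 -> 0 < u x.
Proof.
move=> n3 cu u0 lu p0 up x0.
have [rho rho0 uball] := gt_half_ball (cu p p0) up.
have up2 : 0 < u p / 2 by rewrite divr_gt0.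
have [xr|xr] := leP (sqn (x - p)) rho; first by have := uball x xr; lra.
apply: lt_le_trans (@superharmonic_ge_pole _ u p rho _ n3 erefl rho0 up2 cu u0 lu
  (fun y _ => uball y) x x0 (ltW xr)).
rewrite !mulr_gt0// ?powR_gt0// invfac_gt0//.
by apply/eqP => xp; move: xr; rewrite xp subrr sqn0; lra.
Qed.

Lemma sqn_subZ (s : R) x y : sqn (x - s *: y) = sqn x - 2 * s * rowdot y x + s ^+ 2 * sqn y.
Proof.
rewrite /sqn /rowdot !mulr_sumr -sumrN -!big_split; apply: eq_bigr => i _ /=.
by rewrite !mxE; ring.
Qed.

(** Combines exp v >= 1 + v with ln t >= 1 - 1/t. Applied to the ratio of the squared distances to
    the two poles, it gives the linear growth of the Green function off the sphere. *)
Lemma powR_ge_bernoulli k (t : R) : 0 <= k -> 0 < t -> 1 + k * (1 - t^-1) <= t `^ k.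
Proof.
move=> k0 t0; rewrite /powR gt_eqF//; apply: le_trans (expR_ge1Dx _).
rewrite lerD2l ler_wpM2l//.
have ti0 : 0 < t^-1 by rewrite invr_gt0.
have t1 : -1 < t^-1 - 1 by lra.
have := le_ln1Dx t1; rewrite (_ : 1 + _ = t^-1); last by ring.
by rewrite lnV ?posrE//; lra.
Qed.

(* The barrier is the Dirichlet Green function of the exterior of the sphere with
   pole p; the reflected pole p' makes it vanish on the sphere. *)
Lemma exterior_lb k x l w p : (3 <= n)%N -> k = (n%:R - 2) / 2 -> 0 < l ->
  let E := [set y | l <= sqn (y - x)] in
  (forall y, E y -> y != 0 -> {for y, continuous w}) ->
  (forall y, E y -> y != 0 -> 0 <= w y) ->
  (forall y, l < sqn (y - x) -> y != 0 -> exists2 L, lap_at w y L & L <= 0) ->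
  l < sqn (p - x) -> p != 0 -> 0 < w p ->
  exists2 c, 0 < c & forall y, E y -> y != 0 ->
    c * ((1 - invfac x l y) * invfac x l y `^ k) <= w y.
Proof.
move=> n3 kE l0 E cw w0 lw Pl p0 wp.
have n3' : 3 <= n%:R :> R by rewrite (ler_nat R 3).
have k0 : 0 < k by rewrite kE; lra.
set P := p - x in Pl.
have [rho rho0 wball] := gt_half_ball (cw p (ltW Pl) p0) wp.
pose m := w p / 2; have m0 : 0 < m by rewrite divr_gt0.
pose s := l / sqn P; have P0 : 0 < sqn P by lra.
have s0 : 0 < s by rewrite divr_gt0.
have sP : s * sqn P = l by rewrite divfK// gt_eqF.
have s1 : s < 1 by rewrite ltr_pdivrMr// mul1r.
pose p' := x + s *: P.
have yp' y : y - p' = y - x - s *: P by rewrite /p' opprD addrA.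
have yp y : y - p = y - x - 1 *: P by apply/rowP => i; rewrite !mxE; ring.
have Ep' y : E y -> y != p'.
  move=> Ey; apply/eqP => ye; move: Ey; rewrite /E /= ye /p' addrAC subrr add0r sqnZ.
  by rewrite expr2 -mulrA sP; nra.
(* Squared distances to the two poles, the second rescaled so that both agree on the sphere; [ba]
   factors their difference, and [H] is [a] to the power [- k] minus [b] to the power [- k]. *)
pose a y := sqn (y - p); pose b y := sqn P / l * sqn (y - p').
have ba y : b y - a y = (sqn (y - x) - l) * (sqn P - l) / l.
  by rewrite /b /a yp' yp !sqn_subZ /s; field; lra.
pose H y := invfac p 1 y `^ k + - 1 * invfac p' s y `^ k.
have invp' y : invfac p' s y = (b y)^-1.
  by rewrite /invfac /b /s !invfM invrK; ring.
have q0 y : E y -> 0 < sqn (y - x) by move=> Ey; exact: lt_le_trans l0 Ey.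
have b0 y : E y -> 0 < b y.
  by move=> Ey; rewrite mulr_gt0 ?divr_gt0// sqn_gt0 subr_eq0 Ep'.
have a0 y : y != p -> 0 < a y by rewrite sqn_gt0 subr_eq0.
have bq y : E y -> b y <= 4 * sqn P * (invfac x l y)^-1.
  move=> Ey; have qy := q0 y Ey.
  have -> : 4 * sqn P * (invfac x l y)^-1 = sqn P / l * (4 * sqn (y - x)).
    by rewrite /invfac; field; rewrite !gt_eqF.
  rewrite /b yp' ler_pM2l ?divr_gt0//.
  apply: le_trans (sqnB_le _ _) _; rewrite sqnZ expr2 -mulrA sP.
  have lq : l <= sqn (y - x) := Ey.
  by nra.
(* The factor [k] comes from [powR_ge_bernoulli]. The bound [bq] on [b] is used twice: in the power
   of [b], and in the denominator of [(b y - a y) / b y]. *)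
pose c1 := k * (4 * sqn P)^-1 `^ k * ((sqn P - l) / (4 * sqn P)).
have c10 : 0 < c1.
  by rewrite !mulr_gt0 ?powR_gt0 ?invr_gt0 ?mulr_gt0 ?subr_gt0.
have Hge y : E y -> y != p -> c1 * ((1 - invfac x l y) * invfac x l y `^ k) <= H y.
  move=> Ey yp0; have by0 := b0 y Ey; have ay0 := a0 y yp0; have qy := q0 y Ey.
  have sy0 : 0 < invfac x l y by rewrite divr_gt0.
  have sy1 : invfac x l y <= 1 by rewrite ler_pdivrMr// mul1r.
  rewrite /H invp' mulN1r.
  have -> : invfac p 1 y = b y / a y * (b y)^-1.
    by rewrite /invfac -/(a y); field; rewrite !gt_eqF.
  have bi0 : 0 <= (b y)^-1 by rewrite invr_ge0 ltW.
  rewrite powRM ?divr_ge0 ?(ltW by0) ?(ltW ay0)//.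
  set T := (b y / a y) `^ k; set B := (b y)^-1 `^ k.
  rewrite (_ : T * B - B = (T - 1) * B); last by ring.
  have tk : _ <= T := powR_ge_bernoulli (ltW k0) (divr_gt0 by0 ay0).
  have ab1 : 1 - (b y / a y)^-1 = (b y - a y) / b y by rewrite invf_div; field; rewrite gt_eqF.
  rewrite ab1 in tk.
  have ba2 : (1 - invfac x l y) * ((sqn P - l) / (4 * sqn P)) <= (b y - a y) / b y.
    rewrite ler_pdivlMr//.
    have h0 : 0 <= (1 - invfac x l y) * ((sqn P - l) / (4 * sqn P)).
      by rewrite mulr_ge0 ?divr_ge0//; lra.
    apply: le_trans (ler_wpM2l h0 (bq y Ey)) _.
    rewrite ba /invfac le_eqVlt; apply/orP; left; apply/eqP.
    by field; rewrite !gt_eqF.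
  have bk : (4 * sqn P)^-1 `^ k * invfac x l y `^ k <= (b y)^-1 `^ k.
    have p4 : 0 < (4 * sqn P)^-1 by rewrite invr_gt0 mulr_gt0.
    have ps : 0 < (4 * sqn P)^-1 * invfac x l y by rewrite mulr_gt0.
    rewrite -powRM ?(ltW p4) ?(ltW sy0)//.
    apply: powR_le; [exact: ltW|exact: ltW|].
    by rewrite -[leLHS]invrK lef_pV2 ?posrE ?invr_gt0// invfM invrK bq.
  have -> : c1 * ((1 - invfac x l y) * invfac x l y `^ k) =
     k * ((1 - invfac x l y) * ((sqn P - l) / (4 * sqn P))) *
      ((4 * sqn P)^-1 `^ k * invfac x l y `^ k) by rewrite /c1; ring.
  apply: ler_pM => //.
  - apply: mulr_ge0; [exact: ltW|apply: mulr_ge0; last by apply: divr_ge0; lra].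
    by rewrite subr_ge0.
  - by rewrite mulr_ge0 ?powR_ge0.
  - have := ler_wpM2l (ltW k0) ba2; lra.
have main : forall y, E y -> y != 0 -> rho <= sqn (y - p) -> m * rho `^ k * H y <= w y.
  apply: (@pole_lb k E w H p rho m n3 k0 rho0 m0) => //.
  - exact: closed_sqn_ge.
  - by move=> y _ _; exact: wball.
  - move=> y Ey yp0.
    exact: (cvgD (invfac_pow_continuous (m := k) (l := 1) ltr01 yp0)
      (cvgMl_tmp (a := -1) (invfac_pow_continuous (m := k) s0 (Ep' y Ey)))).
  - by move=> y Ey yp0; rewrite /H mulN1r gerDl oppr_le0 powR_ge0.
  - move=> y Ey yp0; have h1 := @lap_at_pow R n p 1 k y ltr01 yp0.
    have h2 := @lap_at_pow R n p' s k y s0 (Ep' y Ey).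
    have := lap_atD h1 (lap_atZ (- 1) h2).
    have -> : 4 * k + 4 - 2 * n%:R = 0 by rewrite kE; field.
    by rewrite !(mul0r, mulr0, addr0).
  - move=> y Ey y0; have [yl|yl] := ltP l (sqn (y - x)).
      by right; split; [apply: filterS (near_sqn_gt yl) => z /ltW|exact: lw].
    left; have ql : sqn (y - x) = l by apply/eqP; rewrite eq_le yl.
    have ab : b y = a y by have := ba y; rewrite ql subrr !mul0r; lra.
    by rewrite /H invp' ab mulN1r /invfac div1r subrr.
(* The second entry serves in the ball about [p], where [w] is at least [m] and the comparison
   function is at most 1. *)
exists (Num.min (m * rho `^ k * c1) m).
  by rewrite lt_min m0 andbT; apply: mulr_gt0 => //; apply: mulr_gt0 => //; exact: powR_gt0.
move=> y Ey y0; have qy := q0 y Ey.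
have sy0 : 0 < invfac x l y by rewrite divr_gt0.
have sy1 : invfac x l y <= 1 by rewrite ler_pdivrMr// mul1r.
have h0 : 0 <= (1 - invfac x l y) * invfac x l y `^ k by rewrite mulr_ge0 ?powR_ge0//; lra.
have [yr|yr] := leP (sqn (y - p)) rho.
  apply: le_trans (wball y yr); rewrite -/m.
  apply: (@le_trans _ _ (m * ((1 - invfac x l y) * invfac x l y `^ k))).
    by rewrite ler_wpM2r// ge_min lexx orbT.
  rewrite ger_pMr//; apply: mulr_ile1; rewrite ?powR_ge0//; try lra.
  by apply: le_trans (powR_le (ltW k0) (ltW sy0) sy1) _; rewrite powR1.
have yp0 : y != p by apply/eqP => e; move: yr; rewrite e subrr sqn0; lra.
apply: le_trans (main y Ey y0 (ltW yr)).
apply: (@le_trans _ _ (m * rho `^ k * c1 * ((1 - invfac x l y) * invfac x l y `^ k))).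
  by rewrite ler_wpM2r// ge_min lexx.
by rewrite -mulrA ler_pM2l ?Hge// mulr_gt0 ?powR_gt0.
Unshelve. all: by end_near. Qed.

End pole.

(** * Radial monotonicity and moving spheres for one function *)

Section sphere.
Context {R : realType} {n : nat}.
Implicit Types (u : 'rV[R]_n -> R) (x y Y : 'rV[R]_n) (l rho k : R).

(* t^k u(x + t Y) has derivative t^(k-1) radial(x + t Y) in t, and the Kelvin transform at
   x + Y is its value at t = invfac, so radial >= 0 gives the comparison along the ray. *)
Definition radial k x u y : R := k * u y + \sum_j partial j u y * (y - x) ord0 j.

Lemma radial_continuous k x u y : Ck 1 (punctured R n) u -> y != 0 ->
  {for y, continuous (radial k x u)}.
Proof.
move=> u1 y0; apply: (@cvgD R _ _ (nbhs y) _ (fun y => k * u y)).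
  by apply: cvgMl_tmp; case: u1 => + _; apply.
apply: (@cvg_sumR R _ (nbhs y)) => j.
have [_ cp] := Ck1_near j open_punctured u1 y0.
apply: cvgM; first exact: cp.
have c := @coord_continuous R 1 n ord0 j y.
under eq_fun do rewrite !mxE.
have -> : (y - x) ord0 j = y ord0 j - x ord0 j by rewrite !mxE.
by apply: (@cvgB R R _ (nbhs y) _ (fun z => z ord0 j)); [exact: c|exact: cvg_cst].
Qed.

Lemma ray_neq0 x Y t : t ^+ 2 * sqn Y < sqn x -> x + t *: Y != 0.
Proof.
move=> h; apply/eqP => /eqP; rewrite addr_eq0 => /eqP e.
by move: h; rewrite e sqnN sqnZ ltxx.
Qed.

Lemma is_derive_ray k x u Y t : Ck 1 (punctured R n) u -> 0 < t -> x + t *: Y != 0 ->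
  is_derive t (1:R) (fun t => t `^ k * u (x + t *: Y))
    (t `^ k / t * radial k x u (x + t *: Y)).
Proof.
move=> u1 t0 z0.
have dz j : is_derive t (1:R) (fun s => (x + s *: Y) ord0 j) (Y ord0 j).
  have -> : (fun s => (x + s *: Y) ord0 j) = (fun s => x ord0 j + s * Y ord0 j).
    by apply/funext => s; rewrite !mxE.
  have d1 := is_deriveM (is_derive_id t (1:R)) (is_derive_cst (Y ord0 j) t (1:R)).
  apply: (is_derive_eq (is_deriveD (is_derive_cst (x ord0 j) t (1:R)) d1)).
  by rewrite /GRing.scale /=; ring.
have du : is_derive t (1:R) (fun s => u (x + s *: Y)) (\sum_j partial j u (x + t *: Y) * Y ord0 j).
  apply: C1_curve dz => j; by have [] := Ck1_near j open_punctured u1 z0.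
apply: (is_derive_eq (is_deriveM (is_derive1_powR k t0) du)).
have tN0 : t != 0 by rewrite gt_eqF.
rewrite /GRing.scale /= /radial powRB ?tN0 ?implybT// powRr1 ?(ltW t0)//.
have -> : \sum_j partial j u (x + t *: Y) * (x + t *: Y - x) ord0 j =
  t * \sum_j partial j u (x + t *: Y) * Y ord0 j.
  by rewrite mulr_sumr; apply: eq_bigr => j _; rewrite !mxE; ring.
by field.
Qed.

Lemma ray_MVT k x u Y (a b : R) : Ck 1 (punctured R n) u -> 0 < a -> a <= b ->
  (forall t, a <= t <= b -> x + t *: Y != 0) ->
  exists2 t, a <= t <= b & b `^ k * u (x + b *: Y) - a `^ k * u (x + a *: Y) =
    t `^ k / t * radial k x u (x + t *: Y) * (b - a).
Proof.
move=> u1 a0 ab z0.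
have d t : a <= t <= b -> is_derive t (1:R) (fun t => t `^ k * u (x + t *: Y))
    (t `^ k / t * radial k x u (x + t *: Y)).
  by move=> tab; apply: is_derive_ray (z0 t tab) => //; lra.
have [|||t tab E] := @MVT_segment R (fun t => t `^ k * u (x + t *: Y))
   (fun t => t `^ k / t * radial k x u (x + t *: Y)) a b.
- exact: ab.
- by move=> t; rewrite in_itv /= => tab; apply: d; lra.
- apply: derivable_within_continuous => t; rewrite in_itv /= => tab.
  by case: (d t tab).
- by exists t; [move: tab; rewrite in_itv|].
Qed.

Lemma kelvin_ray x l k u y : kelvin x l k u y =
  invfac x l y `^ k * u (x + invfac x l y *: (y - x)).
Proof. by []. Qed.

Lemma kelvin_le k x l u y : Ck 1 (punctured R n) u -> 0 < l -> y != x ->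
  l <= sqn (y - x) ->
  (forall t, invfac x l y <= t <= 1 ->
    x + t *: (y - x) != 0 /\ 0 <= radial k x u (x + t *: (y - x))) ->
  kelvin x l k u y <= u y.
Proof.
move=> u1 l0 yx lq H; have s0 := invfac_gt0 l0 yx.
have s1 : invfac x l y <= 1 by rewrite ler_pdivrMr ?mul1r// sqn_gt0 subr_eq0.
have [|t tab] := @ray_MVT k x u (y - x) _ _ u1 s0 s1; first by move=> t /H[].
have [_ Ft] := H t tab.
rewrite powR1 mul1r scale1r [x + (y - x)]addrC subrK -/(kelvin x l k u y) => E.
rewrite -subr_ge0 E mulr_ge0 ?subr_ge0// mulr_ge0// divr_ge0 ?powR_ge0//; lra.
Qed.

(** Near [x] the term [k * u] dominates in [radial], so the comparison holds along rays inside a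
    fixed ball. Outside it, [u] is at least a fixed multiple of the fundamental solution with pole
    [x], while the transform is a multiple of it that shrinks with [l]. *)
Lemma sphere_start k x u : (3 <= n)%N -> k = (n%:R - 2) / 2 -> x != 0 ->
  Ck 1 (punctured R n) u -> (forall y, y != 0 -> 0 <= u y) -> superharmonic_off0 u -> 0 < u x ->
  exists2 l0, 0 < l0 & forall l, 0 < l <= l0 -> forall y, y != 0 -> l <= sqn (y - x) ->
    kelvin x l k u y <= u y.
Proof.
move=> n3 kE x0 u1 u0 lu ux.
have n3' : 3 <= n%:R :> R by rewrite (ler_nat R 3).
have k0 : 0 < k by rewrite kE; lra.
have cu y : y != 0 -> {for y, continuous u} by case: u1 => + _; apply.
have Fx : 0 < radial k x u x.
  rewrite /radial big1 ?addr0 ?mulr_gt0// => j _.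
  by rewrite subrr mxE mulr0.
have [rho rho0 rhoP] : exists2 rho, 0 < rho & forall y, sqn (y - x) <= rho ->
    [/\ y != 0, 0 < radial k x u y, u x / 2 < u y & u y < 2 * u x].
  have ux2 : u x / 2 < u x by lra.
  have ux3 : u x < 2 * u x by lra.
  apply: near_sqn_ball; near=> y; split; near: y.
  - exact: open_nbhs_nbhs (conj open_punctured x0).
  - exact: (cvgr_gt _ (radial_continuous (k := k) (x := x) u1 x0)).
  - exact: (cvgr_gt _ (cu x x0)).
  - exact: (cvgr_lt _ (cu x x0)).
have ux2 : 0 < u x / 2 by lra.
have lb := @superharmonic_ge_pole R n k u x rho _ n3 kE rho0 ux2 cu u0 lu
   (fun y _ yr => ltW (let: And4 _ _ h _ := rhoP y yr in h)).
(* Its power [k] is 1/4, the ratio of the lower bound [u x / 2] to the upper bound [2 * u x];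
   [a <= 1] keeps the reflected points in the ball. *)
pose a : R := 4^-1 `^ k^-1.
have a0 : 0 < a by rewrite powR_gt0 ?invr_gt0.
have ak : a `^ k = 4^-1 by rewrite /a -powRrM mulVf ?powRr1 ?invr_ge0// gt_eqF.
have a1 : a <= 1.
  have e1 : 1 `^ k^-1 = 1 :> R by rewrite powR1.
  rewrite -[leRHS]e1; apply: powR_le; rewrite ?invr_ge0 ?(ltW k0)//.
  by rewrite invf_le1//; lra.
exists (rho * a); first exact: mulr_gt0.
move=> l /andP[l0 lr] y y0 lq.
have q0 : 0 < sqn (y - x) by lra.
have yx : y != x by rewrite -subr_eq0 -sqn_gt0.
have s0 := invfac_gt0 l0 yx.
have s1 : invfac x l y <= 1 by rewrite ler_pdivrMr ?mul1r.
have lrho : l <= rho by apply: le_trans lr _; rewrite ger_pMr.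
have [yr|yr] := leP (sqn (y - x)) rho.
  apply: kelvin_le => // t /andP[t0 t1].
  have [//|z0 Fz _ _] := rhoP (x + t *: (y - x)).
    rewrite addrAC subrr add0r sqnZ; apply: le_trans yr; rewrite ger_pMl//.
    by rewrite expr_le1//; lra.
  by split => //; exact: ltW.
apply: le_trans (lb y y0 (ltW yr)).
have sE : invfac x l y = l * invfac x 1 y by rewrite /invfac div1r.
have i0 : 0 <= invfac x 1 y by rewrite divr_ge0 ?sqn_ge0.
rewrite /kelvin.
have [|z0 _ _ uz] := rhoP (x + invfac x l y *: (y - x)).
  rewrite addrAC subrr add0r sqnZ expr2 -mulrA divfK ?gt_eqF//.
  by apply: le_trans lrho; rewrite ger_pMl.
rewrite [X in X `^ _ * _]sE powRM ?(ltW l0)// mulrAC ler_wpM2r ?powR_ge0//.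
apply: (@le_trans _ _ ((rho * a) `^ k * (2 * u x))).
  by apply: ler_pM; rewrite ?powR_ge0 ?u0 ?powR_le ?(ltW k0) ?(ltW l0) ?(ltW uz).
rewrite powRM ?ak ?(ltW rho0) ?(ltW a0)//; lra.
Unshelve. all: by end_near. Qed.

End sphere.

(** * Openness: from one sphere to slightly larger ones *)

Section sphere_open.
Context {R : realType} {n : nat}.
Implicit Types (u : 'rV[R]_n -> R) (x y Y : 'rV[R]_n) (l rho k : R).

Lemma compact_annulus x (a b : R) : compact [set y | a <= sqn (y - x) /\ sqn (y - x) <= b].
Proof.
apply: bounded_closed_compact.
  exists (`|x| + (1 + b)); split; first exact: num_real.
  move=> M bM y [_ /= yb].
  have yx : `|y| <= `|y - x| + `|x| by have := ler_normD (y - x) x; rewrite subrK.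
  have h : `|y - x| <= 1 + b by have := le_trans (sqn_norm_ge _) yb; nra.
  lra.
apply: closedI; first exact: closed_sqn_ge.
by apply: closed_le_continuous; exact: sqnB_continuous.
Qed.

Lemma radial_pos_annulus k x u l : Ck 1 (punctured R n) u -> 0 < l -> l < sqn x ->
  (forall y, sqn (y - x) = l -> 0 < radial k x u y) ->
  exists d : R, [/\ 0 < d, l + d < sqn x &
    forall y, l - d <= sqn (y - x) <= l + d -> 0 < radial k x u y].
Proof.
move=> u1 l0 lx Fpos.
pose e := (sqn x - l) / 2; have e0 : 0 < e by rewrite /e; lra.
have A0 y : sqn (y - x) <= l + e -> y != 0.
  by apply: contraTneq => ->; rewrite sub0r sqnN -ltNge /e; lra.
(* Off the sphere the first term is positive; on it the second is, being twice the positive part of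
   [radial]. Closer to the sphere than the minimum of [G], the second term cannot vanish. *)
pose G y := `|sqn (y - x) - l| + (radial k x u y + `|radial k x u y|).
have G0 y : 0 < G y.
  rewrite /G; have [yl|yl] := eqVneq (sqn (y - x)) l.
    by have := Fpos y yl => F0; rewrite yl subrr normr0 gtr0_norm; lra.
  have : 0 < `|sqn (y - x) - l| by rewrite normr_gt0 subr_eq0.
  by have := ler_norm (- radial k x u y); rewrite normrN; lra.
pose A := [set y | l - e <= sqn (y - x) /\ sqn (y - x) <= l + e].
have [A00|AN0] := pselect (A !=set0); last first.
  exists (e / 2); split; [lra|rewrite /e; lra|move=> y /andP[y1 y2]].
  by exfalso; apply: AN0; exists y; split; lra.
have cG : {within A, continuous G}.
  apply: continuous_in_subspaceT => y /set_mem [_ yA].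
  have cF := @radial_continuous R n k x u y u1 (A0 y yA).
  have c1 : (sqn (z - x) - l) @[z --> y] --> sqn (y - x) - l.
    by apply: (@cvgB R R _ (nbhs y) _ (fun z => sqn (z - x))); [exact: sqnB_continuous|exact: cvg_cst].
  exact: (cvgD (cvg_norm c1) (cvgD cF (cvg_norm cF))).
have [c _ cmin] := EVT_min_rV A00 (@compact_annulus x _ _) cG.
pose d := Num.min e (G c) / 2.
have [d0 de dG] : [/\ 0 < d, d < e & d < G c].
  have := G0 c; rewrite /d; case: (ltP e (G c)) => h ?; split; lra.
exists d; split => //; first by move: de; rewrite /e; lra.
move=> y /andP[y1 y2]; have : G c <= G y by apply: cmin; apply/mem_set; split; lra.
have dy : `|sqn (y - x) - l| <= d by rewrite ler_norml; lra.
rewrite {2}/G => Gcy; rewrite ltNge; apply/negP => F0.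
by move: Gcy; rewrite (ler0_norm F0); lra.
Qed.

(** On the ray through a point of the sphere, t^k times the difference is phi(t) - phi(1/t) for
    phi(t) = t^k u(x + t Y). Its derivative at 1 is twice [radial], and the assumed gap is at least
    linear in t - 1. *)
Lemma radial_pos_sphere k x u l c : 0 < k -> Ck 1 (punctured R n) u -> 0 < l -> l < sqn x -> 0 < c ->
  (forall y, y != 0 -> l <= sqn (y - x) ->
    c * ((1 - invfac x l y) * invfac x l y `^ k) <= u y - kelvin x l k u y) ->
  forall y, sqn (y - x) = l -> 0 < radial k x u y.
Proof.
move=> k0 u1 l0 lx c0 lb y yl.
have x0 : 0 < sqn x by lra.
(* [d <= 1] keeps [t] below 2, whence the power of 1/2 in [C]; the other entry keeps the ray away
   from the origin. *)
pose d := Num.min 1 ((sqn x / l - 1) / 4).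
have d0 : 0 < d by rewrite lt_min ltr01 /= divr_gt0// subr_gt0 ltr_pdivlMr// mul1r.
have d1 : d <= 1 by rewrite ge_min lexx.
have dl : 4 * d * l <= sqn x - l.
  have : d <= (sqn x / l - 1) / 4 by rewrite ge_min lexx orbT.
  rewrite -(ler_pM2r l0) => h; have E : (sqn x / l - 1) / 4 * l = (sqn x - l) / 4 by field; lra.
  by move: h; rewrite E; lra.
set Y := y - x in yl *.
have ray t : 0 <= t -> t < 1 + d -> x + t *: Y != 0.
  move=> t0 td; apply: ray_neq0; rewrite yl.
  have : t ^+ 2 < 1 + 3 * d by nra.
  by nra.
pose phi (t : R) := t `^ k * u (x + t *: Y).
pose C := c * (2^-1 `^ k) / 2.
have C0 : 0 < C by rewrite divr_gt0// mulr_gt0// powR_gt0// invr_gt0.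
have xY : x + 1 *: Y = y by rewrite scale1r /Y addrC subrK.
have dphi : is_derive (1:R) (1:R) phi (radial k x u y).
  have := @is_derive_ray R n k x u Y 1 u1 ltr01; rewrite xY powR1 divr1 mul1r.
  by apply; rewrite -xY ray//; lra.
have dphiV : is_derive (1:R) (1:R) (fun t => phi t^-1) (- radial k x u y).
  have i1 : is_derive (1:R) (1:R) (fun t : R => t^-1) (-1).
    have := @is_deriveV R id 1 1 1 (oner_neq0 _) (is_derive_id _ _).
    by rewrite expr1n invr1 /GRing.scale /= mulr1.
  have dphi1 : is_derive ((1:R)^-1) (1:R) phi (radial k x u y) by rewrite invr1.
  have := is_derive1_comp dphi1 i1; rewrite mulrN1; exact.
have dlin : is_derive (1:R) (1:R) (fun t : R => C * (t - 1)) C.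
  have h := is_deriveB (is_derive_id (1:R) (1:R)) (is_derive_cst (1:R) (1:R) (1:R)).
  apply: (is_derive_eq (is_deriveZ C h)).
  by rewrite /GRing.scale /= subr0 mulr1.
pose psi t := phi t - phi t^-1 - C * (t - 1).
have dpsi : is_derive (1:R) (1:R) psi (radial k x u y - - radial k x u y - C).
  exact: is_deriveB (is_deriveB dphi dphiV) dlin.
suff : 0 <= radial k x u y - - radial k x u y - C by lra.
apply: (is_derive_right_ge0 dpsi d0) => t /andP[t1 td].
rewrite {1}/psi invr1 !subrr mulr0 subr0 /psi.
have t0 : 0 < t by lra.
have ti1 : t^-1 <= 1 by rewrite invf_le1.
have ti0 : 0 < t^-1 by rewrite invr_gt0.
have z0 : x + t *: Y != 0 by apply: ray; lra.
have zY : x + t *: Y - x = t *: Y by rewrite addrAC subrr add0r.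
have zl : l <= sqn (x + t *: Y - x).
  by rewrite zY sqnZ yl ler_peMl ?(ltW l0)// expr_ge1//; lra.
have inv : invfac x l (x + t *: Y) = t^-1 ^+ 2.
  by rewrite /invfac zY sqnZ yl; field; rewrite !gt_eqF.
have := lb _ z0 zl; rewrite /kelvin inv zY scalerA.
have -> : t^-1 ^+ 2 * t = t^-1 by field; rewrite gt_eqF.
have tk0 : 0 < t `^ k by rewrite powR_gt0.
have tik : t `^ k * t^-1 `^ k = 1 by rewrite -powRM ?(ltW t0) ?(ltW ti0)// divff ?gt_eqF// powR1.
have tik2 : (t^-1 ^+ 2) `^ k = t^-1 `^ k * t^-1 `^ k by rewrite expr2 powRM ?(ltW ti0).
rewrite tik2 -(ler_pM2l tk0) => h.
have E1 : t `^ k * (u (x + t *: Y) - t^-1 `^ k * t^-1 `^ k * u (x + t^-1 *: Y)) = phi t - phi t^-1.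
  rewrite /phi mulrBr; congr (_ - _).
  by rewrite !mulrA tik mul1r.
have E2 : t `^ k * (c * ((1 - t^-1 ^+ 2) * (t^-1 `^ k * t^-1 `^ k))) =
   c * ((1 - t^-1 ^+ 2) * t^-1 `^ k).
  transitivity (c * ((1 - t^-1 ^+ 2) * (t `^ k * t^-1 `^ k * t^-1 `^ k))); first by ring.
  by rewrite tik mul1r.
rewrite E1 E2 in h.
rewrite subr_ge0; apply: le_trans h.
have a1 : (t - 1) / 2 <= 1 - t^-1 ^+ 2.
  have ti2 : 2^-1 <= t^-1 by rewrite lef_pV2 ?posrE//; lra.
  have tt : t * t^-1 = 1 by rewrite divff// gt_eqF.
  have -> : 1 - t^-1 ^+ 2 = (t - 1) * (t^-1 + t^-1 ^+ 2).
    have -> : (t - 1) * (t^-1 + t^-1 ^+ 2) = t * t^-1 + t * t^-1 * t^-1 - t^-1 - t^-1 ^+2 by ring.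
    by rewrite tt; ring.
  by apply: ler_wpM2l; nra.
have a2 : 2^-1 `^ k <= t^-1 `^ k.
  by apply: powR_le; rewrite ?invr_ge0 ?(ltW k0)// lef_pV2 ?posrE//; lra.
have -> : C * (t - 1) = c * ((t - 1) / 2 * 2^-1 `^ k) by rewrite /C; field.
by rewrite ler_pM2l//; apply: ler_pM; [lra|exact: powR_ge0|exact: a1|exact: a2].
Qed.

(** Up to squared distance [l + d], positivity of [radial] near the sphere gives the comparison
    along rays. Beyond, [1 - invfac] is at least [d / (l + d)], so the gap dominates a multiple of
    the power [k] of [invfac], and so it absorbs the growth of the transform from [l] to [l']. *)
Lemma sphere_open k x u l c : 0 < k -> Ck 1 (punctured R n) u -> 0 < l -> l < sqn x -> 0 < c ->
  (forall y, y != 0 -> l <= sqn (y - x) ->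
    c * ((1 - invfac x l y) * invfac x l y `^ k) <= u y - kelvin x l k u y) ->
  exists2 l1, l < l1 & forall l', l <= l' <= l1 -> forall y, y != 0 -> l' <= sqn (y - x) ->
    kelvin x l' k u y <= u y.
Proof.
move=> k0 u1 l0 lx c0 lb.
have [d [d0 dx Fd]] := radial_pos_annulus u1 l0 lx (radial_pos_sphere k0 u1 l0 lx c0 lb).
have B0 y : sqn (y - x) <= l + d -> y != 0.
  by apply: contraTneq => ->; rewrite sub0r sqnN -ltNge; lra.
have [M0 M0P] : exists M, forall y, sqn (y - x) <= l + d -> radial k x u y <= M.
  have [||c' _ cP] := @EVT_max_rV R n (radial k x u) _ _ (@compact_annulus x 0 (l + d)).
  - by exists x; rewrite /= subrr sqn0; split; lra.
  - apply: continuous_in_subspaceT => y /set_mem [_ yA].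
    exact: radial_continuous (B0 y yA).
  - by exists (radial k x u c') => y yd; apply: cP; apply/mem_set; split=> //; exact: sqn_ge0.
pose M := Num.max M0 1.
have M1 : 0 < M by rewrite lt_max ltr01 orbT.
have MP y : sqn (y - x) <= l + d -> radial k x u y <= M.
  by move=> /M0P h; apply: le_trans h _; rewrite le_max lexx.
have p2 : 0 < 2 `^ k :> R by rewrite powR_gt0.
(* [e <= d] keeps the reflected points where [M] bounds [radial]; [e <= l] gives [l' <= 2 * l],
   whence the power of 2; the third entry fits the growth of the transform under the gap. *)
pose e := Num.min d (Num.min l (l * c * d / ((l + d) * 2 `^ k * M))).
have ld0 : 0 < l + d by lra.
have e0 : 0 < e by rewrite !lt_min d0 l0 /= divr_gt0// !mulr_gt0.
have ed : e <= d by rewrite ge_min lexx.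
have el : e <= l by rewrite !ge_min lexx orbT.
have ec : e * ((l + d) * 2 `^ k * M) <= l * c * d.
  by rewrite -ler_pdivlMr ?mulr_gt0// !ge_min lexx !orbT.
exists (l + e); first by lra.
move=> l' /andP[ll' l'e] y y0 l'q.
have l'0 : 0 < l' by lra.
have q0 : 0 < sqn (y - x) by lra.
have yx : y != x by rewrite -subr_eq0 -sqn_gt0.
have ray t : sqn (x + t *: (y - x) - x) = t ^+ 2 * sqn (y - x) by rewrite addrAC subrr add0r sqnZ.
set q := sqn (y - x) in q0 l'q ray.
have [yq|yq] := leP q (l + d).
  apply: kelvin_le => // t /andP[ta tb].
  have t0 : 0 < t by apply: lt_le_trans ta; exact: invfac_gt0.
  have tq : t ^+ 2 * q <= q by rewrite ger_pMl// expr_le1//; lra.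
  split; first by apply: B0; rewrite ray; lra.
  apply: ltW; apply: Fd; rewrite ray; apply/andP; split; last by lra.
  (* At the inner end of the segment the squared distance to [x] is l'^2 / q, at least l^2 / (l +
     d), hence at least l - d. *)
  apply: (@le_trans _ _ (invfac x l' y ^+ 2 * q)).
    rewrite /invfac -/q expr2 -mulrA divfK ?gt_eqF// mulrAC ler_pdivlMr//.
    by nra.
  by rewrite ler_pM2r// ler_pXn2r ?nnegrE// ltW// invfac_gt0.
have lq : l <= q by lra.
apply: le_trans (_ : kelvin x l k u y + c * ((1 - invfac x l y) * invfac x l y `^ k) <= u y); last first.
  by have := lb y y0 lq; lra.
rewrite -lerBlDl.
have s0 : 0 < invfac x l y by exact: invfac_gt0.
have s'0 : 0 < invfac x l' y by exact: invfac_gt0.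
have ss : invfac x l y <= invfac x l' y by rewrite ler_pM2r ?invr_gt0.
have tb t : invfac x l y <= t <= invfac x l' y -> sqn (x + t *: (y - x) - x) <= l + d.
  move=> /andP[ta tb]; rewrite ray.
  have h : t * q <= l' by rewrite -ler_pdivlMr.
  have t1 : t <= 1 by apply: le_trans tb _; rewrite ler_pdivrMr// mul1r.
  by rewrite expr2 -mulrA; nra.
have [|t tab] := @ray_MVT R n k x u (y - x) _ _ u1 s0 ss; first by move=> t /tb; exact: B0.
rewrite -!kelvin_ray => ->.
have Ft := MP _ (tb t tab); have /andP[ta tb'] := tab; have t0 : 0 < t by lra.
have tk : t `^ k <= 2 `^ k * invfac x l y `^ k.
  rewrite -powRM ?(ltW s0)//; apply: powR_le; [exact: ltW|exact: ltW|].
  by apply: le_trans tb' _; rewrite /invfac mulrA ler_pM2r ?invr_gt0//; lra.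
have tf : (invfac x l' y - invfac x l y) / t <= e / l.
  rewrite ler_pdivrMr//; apply: (@le_trans _ _ (e / l * invfac x l y)).
    have -> : e / l * invfac x l y = e / q by rewrite /invfac -/q; field; rewrite !gt_eqF.
    by rewrite /invfac -/q -mulrBl ler_pM2r ?invr_gt0//; lra.
  by rewrite ler_pM2l ?divr_gt0.
have sk0 : 0 < invfac x l y `^ k by rewrite powR_gt0.
have f0 : 0 <= (invfac x l' y - invfac x l y) / t by rewrite divr_ge0//; lra.
have -> : t `^ k / t * radial k x u (x + t *: (y - x)) * (invfac x l' y - invfac x l y) =
  t `^ k * ((invfac x l' y - invfac x l y) / t) * radial k x u (x + t *: (y - x)) by ring.
apply: (@le_trans _ _ (t `^ k * ((invfac x l' y - invfac x l y) / t) * M)).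
  by rewrite ler_wpM2l// mulr_ge0// powR_ge0.
apply: (@le_trans _ _ (2 `^ k * invfac x l y `^ k * (e / l) * M)).
  by rewrite ler_pM2r//; apply: ler_pM => //; exact: powR_ge0.
have d1 : d / (l + d) <= 1 - invfac x l y.
  rewrite /invfac -/q ler_pdivrMr// mulrBl mul1r lerBrDr -lerBrDl.
  have -> : l + d - d = l by ring.
  by rewrite mulrAC ler_pdivrMr//; nra.
have -> : 2 `^ k * invfac x l y `^ k * (e / l) * M = 2 `^ k * (e / l) * M * invfac x l y `^ k by ring.
rewrite [leRHS]mulrA ler_pM2r//; apply: le_trans (ler_wpM2l (ltW c0) d1).
have -> : 2 `^ k * (e / l) * M = e * ((l + d) * 2 `^ k * M) / (l * (l + d)).
  by field; rewrite !gt_eqF.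
have -> : c * (d / (l + d)) = l * c * d / (l * (l + d)) by field; rewrite !gt_eqF.
by rewrite ler_pM2r// invr_gt0 mulr_gt0.
Qed.

End sphere_open.

(** * From spheres to hyperplanes *)

Section kelvin_cont.
Context {R : realType} {n : nat}.
Implicit Types (u : 'rV[R]_n -> R) (x y v : 'rV[R]_n) (l k : R).

Lemma inversion_neq0 x l y : 0 < l -> l < sqn x -> l <= sqn (y - x) ->
  x + invfac x l y *: (y - x) != 0.
Proof.
move=> l0 lx lq; have q0 : 0 < sqn (y - x) by lra.
apply: ray_neq0; apply: le_lt_trans lx.
by rewrite expr2 -mulrA divfK ?gt_eqF// ger_pMl// ler_pdivrMr// mul1r.
Qed.

Lemma kelvin_continuous k x l u y : (forall y, y != 0 -> {for y, continuous u}) ->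
  0 < l -> y != x -> x + invfac x l y *: (y - x) != 0 ->
  {for y, continuous (kelvin x l k u)}.
Proof.
move=> cu l0 yx z0.
have c0 := invfac_pow_continuous (m := k) l0 yx.
have c := @subr_continuous R n x y.
have cz : x + invfac x l z *: (z - x) @[z --> y] --> x + invfac x l y *: (y - x).
  exact: (cvgD (cvg_cst x) (cvgZ (invfac_continuous (l := l) yx) c)).
exact: (cvgM c0 (cvg_comp _ _ cz (cu _ z0))).
Qed.

(** A left limit in [l], used twice: to close the set of admissible [l], and to reach the spheres
    through the origin. *)
Lemma kelvin_le_closed k x l u y : (forall y, y != 0 -> {for y, continuous u}) ->
  0 < l -> 0 < sqn (y - x) -> x + invfac x l y *: (y - x) != 0 ->
  (forall l', 0 < l' < l -> kelvin x l' k u y <= u y) -> kelvin x l k u y <= u y.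
Proof.
move=> cu l0 q0 z0 H.
have ci : invfac x l' y @[l' --> l] --> invfac x l y by apply: cvgMr_tmp; exact: cvg_id.
have s0 : 0 < invfac x l y by rewrite divr_gt0.
have c1 := cvg_comp _ _ ci (@powR_continuous R k _ s0).
have cz : x + invfac x l' y *: (y - x) @[l' --> l] --> x + invfac x l y *: (y - x).
  exact: (cvgD (cvg_cst x) (cvgZr_tmp (a := y - x) ci)).
have c2 := cvg_comp _ _ cz (cu _ z0).
have c3 : kelvin x l' k u y @[l' --> l] --> kelvin x l k u y by exact: cvgM c1 c2.
have c4 : kelvin x l' k u y @[l' --> l^'-] --> kelvin x l k u y.
  exact: cvg_at_left_filter.
apply: (cvgr_to_le c4); near=> l'; apply: H; apply/andP; split.
- by near: l'; exact: nbhs_left_gt.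
- by near: l'; exact: nbhs_left_lt.
Unshelve. all: by end_near. Qed.

End kelvin_cont.

Section reflection.
Context {R : realType} {n : nat}.
Implicit Types (u : 'rV[R]_n -> R) (x y v : 'rV[R]_n) (l k : R).

(* Spheres through the origin centred at (x - y) / t become, as t tends to 0, the
   hyperplane bisecting x and y. *)
Lemma reflection_le k u x y : (forall y, y != 0 -> {for y, continuous u}) ->
  (forall z p, z != 0 -> p != 0 -> sqn z < sqn (p - z) -> kelvin z (sqn z) k u p <= u p) ->
  x != 0 -> y != 0 -> x != y -> sqn x = sqn y -> u x <= u y.
Proof.
move=> cu H x0 y0 xy sxy.
pose v := x - y; pose d := sqn v.
have d0 : 0 < d by rewrite sqn_gt0 subr_eq0.
have vy : 2 * rowdot v y = - d.
  have E := sqn_subZ (-1) y v; move: E.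
  have -> : y - -1 *: v = x by apply/rowP => i; rewrite !mxE; ring.
  by rewrite sxy -/d; lra.
(* For the center [t^-1 *: v], the squared distance to [y] is [N t / t ^+ 2] and the reflected point
   is [Z t]. Neither formula contains [t^-1], so both extend continuously to [t = 0], where
   [Z 0 = x]. *)
pose N (t : R) := d + t * d + t ^+ 2 * sqn y.
pose Z (t : R) := (d / N t) *: y + ((t * sqn y + d) / N t) *: v.
have sy := sqn_ge0 y.
have Npos t : 0 < t -> 0 < N t by move=> t0; rewrite /N; have := mulr_ge0 (sqr_ge0 t) sy; nra.
have key t : 0 < t -> (d / N t) `^ k * u (Z t) <= u y.
  move=> t0; have Nt := Npos t t0; pose z := t^-1 *: v.
  have z0 : z != 0 by rewrite scaler_eq0 negb_or invr_eq0 gt_eqF//= subr_eq0.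
  have qz : sqn z = d / t ^+ 2 by rewrite sqnZ exprVn mulrC.
  have qyz : sqn (y - z) = N t / t ^+ 2.
    rewrite sqn_subZ -[2 * _ * _]mulrAC vy -/d /N; field; by rewrite gt_eqF.
  have lt : sqn z < sqn (y - z).
    rewrite qz qyz ltr_pM2r ?invr_gt0 ?exprn_gt0// /N.
    by have := mulr_ge0 (sqr_ge0 t) sy; nra.
  have := H z y z0 y0 lt.
  have iE : invfac z (sqn z) y = d / N t.
    by rewrite /invfac qz qyz; field; rewrite !gt_eqF.
  rewrite /kelvin iE; congr (_ * u _ <= _).
  apply/rowP => i; rewrite !mxE; rewrite /N; field.
  by rewrite -/(N t) !gt_eqF.
have cid : t @[t --> (0:R)] --> (0:R) by exact: cvg_id.
have cN : N t @[t --> (0:R)] --> N 0.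
  exact: (cvgD (cvgD (cvg_cst d) (cvgMr_tmp (b := d) cid)) (cvgMr_tmp (b := sqn y) (cvgM cid cid))).
have N0 : N 0 = d by rewrite /N expr0n !mul0r !addr0.
have N0n : N 0 != 0 by rewrite N0 gt_eqF.
have ca : d / N t @[t --> (0:R)] --> d / N 0.
  exact: (cvgMl_tmp (a := d) (cvgV N0n cN)).
have cb : (t * sqn y + d) / N t @[t --> (0:R)] --> (0 * sqn y + d) / N 0.
  exact: (cvgM (cvgD (cvgMr_tmp (b := sqn y) cid) (cvg_cst d)) (cvgV N0n cN)).
have cZ : Z t @[t --> (0:R)] --> Z 0.
  exact: (cvgD (cvgZr_tmp (a := y) ca) (cvgZr_tmp (a := v) cb)).
have Z0 : Z 0 = x.
  rewrite /Z N0 mul0r add0r divff ?gt_eqF// !scale1r.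
  by apply/rowP => i; rewrite !mxE; ring.
have Z0n : Z 0 != 0 by rewrite Z0.
have a0 : 0 < d / N 0 by rewrite divr_gt0// N0.
have c : (d / N t) `^ k * u (Z t) @[t --> (0:R)] --> (d / N 0) `^ k * u (Z 0).
  exact: (cvgM (cvg_comp _ _ ca (@powR_continuous R k _ a0)) (cvg_comp _ _ cZ (cu _ Z0n))).
have c' := cvg_at_right_filter c.
have -> : u x = (d / N 0) `^ k * u (Z 0) by rewrite Z0 N0 divff ?gt_eqF// powR1 mul1r.
apply: (cvgr_to_le c'); near=> t; apply: key.
by near: t; exact: nbhs_right_gt.
Unshelve. all: by end_near. Qed.

End reflection.

(** * The system *)

Section enorm.
Context {R : realType} {m : nat}.
Implicit Types (a b : 'rV[R]_m).

Lemma enorm_ge0 a : 0 <= enorm a.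
Proof. exact: sqrtr_ge0. Qed.

Lemma enormZ (c : R) a : 0 <= c -> enorm (c *: a) = c * enorm a.
Proof.
by move=> c0; rewrite /enorm -/(sqn (c *: a)) sqnZ sqrtrM ?sqr_ge0// sqrtr_sqr ger0_norm.
Qed.

Lemma enorm_le a b : (forall i, 0 <= a ord0 i <= b ord0 i) -> enorm a <= enorm b.
Proof.
move=> ab; apply: ler_wsqrtr; apply: ler_sum => i _.
have /andP[a0 aib] := ab i.
by rewrite ler_pXn2r ?nnegrE//; apply: le_trans aib.
Qed.

Lemma enorm_le_sum a : (forall i, 0 <= a ord0 i) -> enorm a <= \sum_i a ord0 i.
Proof.
move=> a0; have s0 : 0 <= \sum_i a ord0 i by exact: sumr_ge0.
rewrite -[leRHS](ger0_norm s0) -sqrtr_sqr; apply: ler_wsqrtr.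
rewrite expr2 mulr_suml; apply: ler_sum => i _.
rewrite expr2 ler_wpM2l// (bigD1 i)//= lerDl.
by apply: sumr_ge0.
Qed.

End enorm.

Section system.
Context {R : realType} {n : nat}.
Variables (hn : (3 <= n)%N) (k s c : R).
Hypotheses (kE : k = (n%:R - 2) / 2) (ks : k * s = 2) (c0 : 0 < c).
Variable U : 'rV[R]_n -> 'rV[R]_2.
Let u (i : 'I_2) := component U i.
Let N x := enorm (U x).
Hypothesis U_C2 : forall i, Ck 2 (punctured R n) (u i).
Hypothesis U_ge0 : forall i x, punctured R n x -> 0 <= u i x.
Hypothesis U_eq : forall i x, punctured R n x ->
  laplacian (u i) x + c * N x `^ s * u i x = 0.
Hypothesis U_singular : N x @[x --> (0 : 'rV[R]_n)^'] --> +oo.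

Implicit Types (x y p : 'rV[R]_n) (l : R) (i : 'I_2).

Let n3 : 3 <= n%:R :> R. Proof. by rewrite (ler_nat R 3). Qed.
Let k0 : 0 < k. Proof. by rewrite kE; have := n3; lra. Qed.
Let s0 : 0 < s. Proof. by rewrite -(pmulr_rgt0 _ k0) ks. Qed.

Let uC1 i : Ck 1 (punctured R n) (u i).
Proof. by case: (U_C2 i) => ? H; split => // j; have [? [? _]] := H j. Qed.

Let u_cont i y : y != 0 -> {for y, continuous (u i)}.
Proof. by case: (U_C2 i) => + _; apply. Qed.

Let lap_u i y : y != 0 -> lap_at (u i) y (- (c * N y `^ s * u i y)).
Proof.
move=> y0; have := lap_at_C2 open_punctured (U_C2 i) y0.
by have /eqP := U_eq i y0; rewrite addr_eq0 => /eqP ->.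
Qed.

Let superharmonic_u i : superharmonic_off0 (u i).
Proof.
move=> y y0; exists (- (c * N y `^ s * u i y)); first exact: lap_u.
rewrite oppr_le0; apply: mulr_ge0; last exact: U_ge0.
by apply: mulr_ge0; [exact: ltW c0|exact: powR_ge0].
Qed.

(** Conformal invariance of the system: by [k * s = 2], the factor [invfac ^+ 2] produced by the
    inversion is exactly what the nonlinearity absorbs. *)
Let lap_kelvin_u x l i y : 0 < l -> y != x -> x + invfac x l y *: (y - x) != 0 ->
  lap_at (kelvin x l k (u i)) y
   (- (c * (invfac x l y `^ k * N (x + invfac x l y *: (y - x))) `^ s * kelvin x l k (u i) y)).
Proof.
move=> l0 yx z0.
have := lap_at_kelvin k l0 yx open_punctured (U_C2 i) z0.
have -> : 4 * k + 4 - 2 * n%:R = 0 by rewrite kE; field.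
rewrite !mul0r addr0; have /eqP := U_eq i z0; rewrite addr_eq0 => /eqP ->.
have i0 : 0 < invfac x l y by exact: invfac_gt0.
rewrite powRM ?powR_ge0 ?enorm_ge0// -powRrM ks.
rewrite (@powR_mulrn _ _ 2 (ltW i0)) /kelvin.
by congr lap_at; ring.
Qed.

(** Both components at once: the sign in [lap_diff] rests on comparing the norms. *)
Definition ordered x l := forall i y, y != 0 -> l <= sqn (y - x) -> kelvin x l k (u i) y <= u i y.

Let enorm_kelvin_le x l y : ordered x l -> 0 < l -> l < sqn x -> y != 0 -> l <= sqn (y - x) ->
  invfac x l y `^ k * N (x + invfac x l y *: (y - x)) <= N y.
Proof.
move=> ord l0 lx y0 lq; have z0 := inversion_neq0 l0 lx lq.
rewrite -enormZ ?powR_ge0//; apply: enorm_le => i; rewrite !mxE.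
by rewrite mulr_ge0 ?powR_ge0 ?(U_ge0 i z0)//=; exact: ord.
Qed.

Let lap_diff x l i y : ordered x l -> 0 < l -> l < sqn x -> y != 0 -> l <= sqn (y - x) ->
  exists2 L, lap_at (fun y => u i y + - 1 * kelvin x l k (u i) y) y L & L <= 0 /\
   (L = c * ((invfac x l y `^ k * N (x + invfac x l y *: (y - x))) `^ s * kelvin x l k (u i) y)
     - c * (N y `^ s * u i y)).
Proof.
move=> ord l0 lx y0 lq; have z0 := inversion_neq0 l0 lx lq.
have q0 : 0 < sqn (y - x) by lra.
have yx : y != x by rewrite -subr_eq0 -sqn_gt0.
eexists; first exact: lap_atD (lap_u i y0) (lap_atZ (- 1) (lap_kelvin_u i l0 yx z0)).
have Nz0 : 0 <= invfac x l y `^ k * N (x + invfac x l y *: (y - x)).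
  by rewrite mulr_ge0 ?powR_ge0 ?enorm_ge0.
split; last by ring.
rewrite mulN1r opprK addrC subr_le0 -!mulrA ler_pM2l//; apply: ler_pM.
- exact: powR_ge0.
- by rewrite mulr_ge0 ?powR_ge0 ?(U_ge0 i z0).
- by apply: powR_le; [exact: ltW|by []|exact: enorm_kelvin_le].
- exact: ord.
Qed.

Let blow_up (B : R) : \forall y \near (0 : 'rV[R]_n), y != 0 -> B < N y.
Proof. by have /cvgryPgt /(_ B) := U_singular; rewrite near_withinE. Qed.

Let punctured_near0 (P : 'rV[R]_n -> Prop) : (\forall y \near (0 : 'rV[R]_n), P y) ->
  exists2 y, y != 0 & P y.
Proof.
move=> /nbhs_normP [e /= e0 eP].
pose j : 'I_n := Ordinal (ltn_trans (ltn0Sn 1) hn).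
pose y : 'rV[R]_n := (e / 2) *: delta_mx ord0 j.
have e2 : 0 < e / 2 by lra.
exists y.
  apply/eqP => /rowP /(_ j); rewrite !mxE !eqxx /= mulr1; lra.
apply: eP => /=; rewrite sub0r normrN.
apply: (@le_lt_trans _ _ (e / 2)); last by lra.
apply: rV_norm_le => [|i]; first exact: ltW.
rewrite !mxE eqxx /=; case: eqP => _; rewrite ?mulr1 ?mulr0 ?normr0 ?gtr0_norm//; lra.
Qed.

(* This is where the singularity is used: the Kelvin transform is bounded near 0. *)
Let strict_somewhere x l i : ordered x l -> 0 < l -> l < sqn x ->
  (forall y, y != 0 -> 0 < u i y) ->
  exists p, [/\ p != 0, l < sqn (p - x) & 0 < u i p + - 1 * kelvin x l k (u i) p].
Proof.
move=> ord l0 lx upos; apply: contrapT => /forallNP H.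
have weq y : y != 0 -> l < sqn (y - x) -> u i y = kelvin x l k (u i) y.
  move=> y0 lq; apply/eqP; rewrite eq_le ord ?(ltW lq)// andbT leNgt; apply/negP => h.
  by apply: (H y); split => //; lra.
(* Where the difference vanishes on an open set, so does its Laplacian; dividing by [u i y > 0]
   leaves a comparison of norms. The blow-up of the norm then contradicts equality even in a
   component that stays bounded. *)
have Nle y : y != 0 -> l < sqn (y - x) ->
    N y <= invfac x l y `^ k * N (x + invfac x l y *: (y - x)).
  move=> y0 lq; have [L lapL [_ LE]] := lap_diff i ord l0 lx y0 (ltW lq).
  have : 0 <= L.
    apply: lap_at_min lapL; rewrite (weq y y0 lq) mulN1r subrr.
    have ny0 : \forall z \near y, z != 0 by exact: open_nbhs_nbhs (conj open_punctured y0).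
    apply: filterS2 ny0 (near_sqn_gt lq) => z z0 lz.
    by rewrite (weq z z0 lz) mulN1r subrr.
  rewrite LE -mulrBr pmulr_rge0// -weq// -mulrBl pmulr_lge0 ?upos// subr_ge0 => h.
  rewrite leNgt; apply/negP => lt.
  have N0' : 0 <= invfac x l y `^ k * N (x + invfac x l y *: (y - x)).
    by rewrite mulr_ge0 ?powR_ge0 ?enorm_ge0.
  have : (invfac x l y `^ k * N (x + invfac x l y *: (y - x))) `^ s < N y `^ s.
    by apply: gt0_ltr_powR => //; rewrite nnegrE// enorm_ge0.
  lra.
have x0 : (0 : 'rV[R]_n) != x by apply/eqP => e; move: lx; rewrite -e sqn0; lra.
have lx0 : l < sqn (0 - x) by rewrite sub0r sqnN.
have z00 := inversion_neq0 l0 lx (ltW lx0).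
pose B := \sum_j (kelvin x l k (u j) 0 + 1).
have kB : \forall y \near (0 : 'rV[R]_n), forall j, kelvin x l k (u j) y < kelvin x l k (u j) 0 + 1.
  apply: (@filter_forall _ _ _ (nbhs (0 : 'rV[R]_n)) _) => j.
  have ck := @kelvin_continuous R n k x l (u j) 0 (@u_cont j) l0 x0 z00.
  by apply: (cvgr_lt _ ck); lra.
have [y y0 [[By kBy] lq]] := punctured_near0 (filterI (filterI (blow_up B) kB) (near_sqn_gt lx0)).
have zy := inversion_neq0 l0 lx (ltW lq).
have := By y0; rewrite ltNge => /negP; apply.
apply: le_trans (Nle y y0 lq) _.
rewrite -enormZ ?powR_ge0//; apply: le_trans (enorm_le_sum _) _ => [j|].
  by rewrite !mxE mulr_ge0 ?powR_ge0 ?(U_ge0 j zy).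
by apply: ler_sum => j _; rewrite !mxE; exact: ltW (kBy j).
Qed.

(** Positivity is what [sphere_start] and [strict_somewhere] require; a vanishing component is
    ordered for trivial reasons. *)
Let u_dichotomy i : (forall y, y != 0 -> 0 < u i y) \/ (forall y, y != 0 -> u i y = 0).
Proof.
have [[p [p0 up]]|H] := pselect (exists p, p != 0 /\ 0 < u i p).
  left=> y y0; apply: (@superharmonic_gt0 R n (u i) p y) => //.
  - by move=> z z0; exact: u_cont.
  - by move=> z z0; exact: U_ge0.
right=> y y0; apply/eqP; rewrite eq_le (U_ge0 i y0) andbT leNgt; apply/negP => uy.
by apply: H; exists y.
Qed.

Let ordered_zero x l i y : (forall y, y != 0 -> u i y = 0) -> 0 < l -> l < sqn x -> y != 0 ->
  l <= sqn (y - x) -> kelvin x l k (u i) y <= u i y.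
Proof.
move=> uz l0 lx y0 lq; rewrite uz// /kelvin uz ?mulr0//.
exact: inversion_neq0.
Qed.

Let ordered_start x : x != 0 -> exists2 l0, 0 < l0 & forall l, 0 < l <= l0 -> ordered x l.
Proof.
move=> x0; have sx : 0 < sqn x by rewrite sqn_gt0.
have H i : exists2 l0, 0 < l0 & forall l, 0 < l <= l0 -> forall y, y != 0 -> l <= sqn (y - x) ->
    kelvin x l k (u i) y <= u i y.
  have [upos|uz] := u_dichotomy i.
    apply: (@sphere_start R n k x (u i) hn kE x0 (uC1 i)) => //; last exact: upos.
    by move=> y y0; exact: U_ge0.
  exists (sqn x / 2); first by lra.
  by move=> l /andP[l0 lx] y; apply: ordered_zero => //; lra.
have [a a0 aP] := H ord0; have [b b0 bP] := H ord_max.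
exists (Num.min a b); first by rewrite lt_min a0.
move=> l /andP[l0]; rewrite le_min => /andP[la lb] i.
have [->|->] : i = ord0 \/ i = ord_max.
  by case: i => -[|[|//]] h; [left|right]; exact: val_inj.
- by apply: aP; rewrite l0.
- by apply: bP; rewrite l0.
Qed.

Let ordered_open x l : ordered x l -> 0 < l -> l < sqn x ->
  exists2 l1, l < l1 & forall l', l <= l' <= l1 -> ordered x l'.
Proof.
move=> ord l0 lx.
have H i : exists2 l1, l < l1 & forall l', l <= l' <= l1 -> forall y, y != 0 ->
    l' <= sqn (y - x) -> kelvin x l' k (u i) y <= u i y.
  have [upos|uz] := u_dichotomy i; last first.
    exists ((l + sqn x) / 2); first by lra.
    by move=> l' /andP[l0' lx'] y; apply: ordered_zero => //; lra.
  have [p [p0 lp wp]] := strict_somewhere ord l0 lx upos.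
  have [|||d d0 dP] := @exterior_lb R n k x l (fun y => u i y + -1 * kelvin x l k (u i) y) p
     hn kE l0 _ _ _ lp p0 wp.
  - move=> y lq y0; have lq' : l <= sqn (y - x) := lq.
    have yx : y != x by rewrite -subr_eq0 -sqn_gt0; lra.
    have ck := kelvin_continuous (k := k) (@u_cont i) l0 yx (inversion_neq0 l0 lx lq').
    exact: (cvgD (@u_cont i y y0) (cvgMl_tmp (a := -1) ck)).
  - by move=> y lq y0; rewrite mulN1r subr_ge0; exact: ord.
  - move=> y lq y0; have [L lL [L0 _]] := lap_diff i ord l0 lx y0 (ltW lq).
    by exists L.
  apply: (sphere_open k0 (uC1 i) l0 lx d0) => y y0 lq.
  by have := dP y lq y0; rewrite mulN1r.
have [a a0 aP] := H ord0; have [b b0 bP] := H ord_max.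
exists (Num.min a b); first by rewrite lt_min a0.
move=> l' /andP[l0']; rewrite le_min => /andP[la lb] i.
have [->|->] : i = ord0 \/ i = ord_max.
  by case: i => -[|[|//]] h; [left|right]; exact: val_inj.
- by apply: aP; rewrite l0'.
- by apply: bP; rewrite l0'.
Qed.

Lemma ordered_all x l : x != 0 -> 0 < l -> l < sqn x -> ordered x l.
Proof.
move=> x0 l0 lx; apply: contrapT => nord.
(* Asking for every smaller [l'] makes [S] an interval, so all positive values below its supremum
   are ordered; the failure at [l] bounds it. *)
pose S := [set m | 0 < m < sqn x /\ forall l', 0 < l' <= m -> ordered x l'].
have Sl m : S m -> m <= l.
  move=> [_ mP]; rewrite leNgt; apply/negP => lm; apply: nord.
  by apply: mP; rewrite l0 ltW.
have ubS : has_ubound S by exists l => m /Sl.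
have [a a0 aP] := ordered_start x0.
pose a' := Num.min a (l / 2).
have a'0 : 0 < a' by rewrite lt_min a0 divr_gt0.
have a'l : a' <= l / 2 by rewrite ge_min lexx orbT.
have Sa : S a'.
  split; first by rewrite a'0 /=; lra.
  by move=> l' /andP[l'0]; rewrite le_min => /andP[l'a _]; apply: aP; rewrite l'0.
have supS : has_sup S by split => //; exists a'.
pose L := sup S.
have La : a' <= L by exact: ub_le_sup.
have Ll : L <= l by apply: ge_sup; [exists a'|move=> m /Sl].
have Lord l' : 0 < l' < L -> ordered x l'.
  move=> /andP[l'0 l'L]; have : 0 < L - l' by lra.
  move=> /(sup_adherent) /(_ supS) [m [_ mP] Lm]; apply: mP.
  by rewrite l'0 /=; move: Lm; rewrite -/L; lra.
have L0 : 0 < L by lra.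
have Lx : L < sqn x by lra.
have ordL : ordered x L.
  move=> i y y0 Lq; apply: kelvin_le_closed => //; first exact: u_cont.
  - by lra.
  - exact: inversion_neq0.
  - by move=> l' l'L; apply: Lord => //; lra.
have [l1 Ll1 l1P] := ordered_open ordL L0 Lx.
pose m := Num.min l1 ((L + sqn x) / 2).
have [Lm ml1 mx] : [/\ L < m, m <= l1 & m < sqn x].
  by rewrite lt_min Ll1 !ge_min lexx /=; split => //; [lra|rewrite gt_min; apply/orP; right; lra].
have : S m.
  split; first by apply/andP; split; lra.
  move=> l' /andP[l'0 l'm]; have [h|h] := ltP l' L; first by apply: Lord; rewrite l'0.
  by apply: l1P; rewrite h /=; lra.
by move=> /(ub_le_sup ubS); rewrite -/L; lra.
Qed.

Lemma radial_component i x y : x != 0 -> y != 0 -> sqn x = sqn y -> u i x <= u i y.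
Proof.
move=> x0 y0 xy; have [->//|xney] := eqVneq x y.
apply: (@reflection_le R n k (u i) x y (@u_cont i)) => // z p z0 p0 zp.
have sz : 0 < sqn z by rewrite sqn_gt0.
have q0 : 0 < sqn (p - z) by lra.
apply: kelvin_le_closed => //; first exact: u_cont.
- apply: ray_neq0; rewrite expr2 -mulrA divfK ?gt_eqF//.
  by rewrite gtr_pMl// ltr_pdivrMr// mul1r.
- move=> l' /andP[l'0 l'z]; apply: ordered_all => //; lra.
Qed.

End system.

Theorem theorem1p1 (R : realType) (n : nat) (hn : (3 <= n)%N)
    (U : 'rV[R]_n -> 'rV[R]_2)
    (U_C2 : forall i : 'I_2, Ck 2 (punctured R n) (component U i))
    (U_ge0 : forall (i : 'I_2) (x : 'rV[R]_n),
       punctured R n x -> 0 <= component U i x)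
    (U_eq : forall (i : 'I_2) (x : 'rV[R]_n), punctured R n x ->
       laplacian (component U i) x
       + n%:R * (n%:R - 2) / 4 * enorm (U x) `^ (4 / (n%:R - 2))
         * component U i x = 0)
    (U_singular : enorm (U x) @[x --> (0 : 'rV[R]_n)^'] --> +oo) :
  radially_symmetric U.
Proof.
move=> x y x0 y0 /eqP.
rewrite eqr_sqrt ?sqn_ge0// => /eqP xy.
have n3 : 3 <= n%:R :> R by rewrite (ler_nat R 3).
have ks : (n%:R - 2) / 2 * (4 / (n%:R - 2)) = 2 :> R by field; lra.
have c0 : 0 < n%:R * (n%:R - 2) / 4 :> R by rewrite divr_gt0// mulr_gt0//; lra.
have le := radial_component hn erefl ks c0 U_C2 U_ge0 U_eq U_singular.
by apply/rowP => i; apply/eqP; rewrite eq_le; apply/andP; split; apply: le.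
Qed.
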